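(* Let $\mathcal{G}$ be a strongly connected digraph on $n\ge 2$ nodes with Laplacian $\mathsf{L}$, let $A_i\in\mathbb{R}^{m\times m}$, $b_i\in\mathbb{R}^m$ for $i\in\{1,\dots,n\}$, put $A=\sum_{i=1}^n A_i$, $b=\sum_{i=1}^n b_i$, and assume that the equation $Ax=b$ has at least one solution $x\in\mathbb{R}^m$. Assume $\mathrm{null}(A)\subseteq\mathrm{null}(A_i)$ for all $i\in\{1,\dots,n\}$. Let $\mathbf{L}=\mathsf{L}\otimes I_m$, $\mathbf{A}=\mathrm{blkdiag}(A_1,\dots,A_n)$, $\mathbf{b}=[b_1;\dots;b_n]$ and $U=\mathbf{1}_n\otimes I_m$. Let $\bar v\in\mathbb{R}^n$ be the positive right eigenvector of $\mathsf{L}$ with eigenvalue $0$ (i.e. $\mathsf{L}\bar v=\mathbf{0}$) satisfying $\mathbf{1}_n^\top\bar v=1$, and let $\bar V=\mathrm{diag}(\bar v)$, $\bar{\mathbf{v}}=\bar v\otimes\mathbf{1}_m\in\mathbb{R}^{mn}$ and $\bar{\mathbf{V}}=\mathrm{diag}(\bar{\mathbf{v}})$. Let $\alpha,\beta>0$ and define $$\bar\gamma=\max\left\{\frac{2}{\lambda_2(\mathsf{L}\bar V+\bar V\mathsf{L}^\top)}\,\lambda_{\max}\!\left(\frac{\mathbf{Q}_{12}^\top\mathbf{Q}_{12}}{\lambda_2(\mathbf{Q}_{11})}-n\beta\mathbf{A}\mathbf{A}^\top\right),\,0\right\},$$ where $$\mathbf{Q}_{11}=\tfrac12\alpha(\mathbf{L}\bar{\mathbf{V}}+\bar{\mathbf{V}}\mathbf{L}^\top)+\beta\mathbf{A}^\top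 UU^\top\mathbf{A},\qquad \mathbf{Q}_{12}=\tfrac12\left(n\beta\mathbf{A}^\top+\alpha\bar{\mathbf{V}}\mathbf{L}^\top\mathbf{A}^\top+\beta\mathbf{A}^\top UU^\top\mathbf{A}\mathbf{A}^\top\right).$$ Then, for all $\gamma\in(\bar\gamma,\infty)$, any trajectory $(\mathbf{x}(t),\mathbf{y}(t),\mathbf{v}(t))\in\mathbb{R}^{mn}\times\mathbb{R}^{mn}\times\mathbb{R}^{mn}$, $t\ge0$, of $$\dot{\mathbf{x}}=-\alpha\mathbf{L}\mathbf{V}\mathbf{x}-n\beta\mathbf{A}^\top\mathbf{y},\qquad \dot{\mathbf{y}}=-\alpha\mathbf{A}\mathbf{L}\mathbf{V}\mathbf{x}-n\beta\mathbf{A}\mathbf{A}^\top\mathbf{y}-\gamma\mathbf{L}\mathbf{V}\mathbf{y},\qquad \dot{\mathbf{v}}=-\mathbf{L}\mathbf{v},$$ where $\mathbf{V}=\mathrm{diag}(\mathbf{v})$, with initial condition satisfying $U^\top\mathbf{y}(0)=U^\top(\mathbf{A}\mathbf{x}(0)-\mathbf{b})$ and $\mathbf{v}(0)=\frac1n\mathbf{1}_{mn}$, converges exponentially to $(\mathbf{x}^*,\mathbf{0},\bar{\mathbf{v}})$, where $\mathbf{x}^*=\mathbf{1}_n\otimes x^*$ and $x^*\in\mathbb{R}^m$ satisfies $Ax^*=b$.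
   Context: A weighted digraph $\mathcal{G}=(\mathcal{V},\mathcal{E},\mathsf{A})$ with $|\mathcal{V}|=n$ has adjacency matrix $\mathsf{A}\in\mathbb{R}^{n\times n}$ with $\mathsf{A}_{ij}>0$ if there is an edge from node $i$ to node $j$, and $\mathsf{A}_{ij}=0$ otherwise. The graph is strongly connected if there is a directed path between any two distinct nodes. The weighted in-degree of node $i$ is $\sum_{j}\mathsf{A}_{ji}$, and $\mathsf{D}^{\mathrm{in}}$ is the diagonal matrix of weighted in-degrees. The Laplacian is $\mathsf{L}=\mathsf{D}^{\mathrm{in}}-\mathsf{A}$ (so $\mathbf{1}_n^\top\mathsf{L}=\mathbf{0}$); when $\mathcal{G}$ is strongly connected, $0$ is a simple eigenvalue of $\mathsf{L}$ and has an entrywise positive right eigenvector. $\mathbf{1}_k\in\mathbb{R}^k$ is the all-ones vector, $I_m$ the $m\times m$ identity, $\otimes$ the Kronecker product, $\mathrm{diag}(w)$ the diagonal matrix with the entries of the vector $w$ on the diagonal, $\mathrm{blkdiag}(A_1,\dots,A_n)\in\mathbb{R}^{mn\times mn}$ the block-diagonal matrix with the given diagonal blocks, and $[b_1;\dots;b_n]\in\mathbb{R}^{mn}$ the stacked vector. $\mathrm{null}(\cdot)$ is the null space, $\lambda_{\max}(\cdot)$ the maximum eigenvalue of a symmetric matrix, and $\lambda_2(\cdot)$ the minimum non-zero eigenvalue of a positive semidefinite matrix (regardless of the multiplicity of the eigenvalue $0$). A trajectory $z(t)$ converges exponentially to $z^*$ if there are constants $C,\mu>0$ with $\|z(t)-z^*\|\le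 Ce^{-\mu t}$ for all $t\ge 0$. *)

(* Defs.v *)
From HB Require Import structures.
From mathcomp Require Import all_boot all_order all_algebra.
From mathcomp Require Import mxtens.
From mathcomp Require Import all_classical all_reals all_analysis.

Set Implicit Arguments.
Unset Strict Implicit.
Unset Printing Implicit Defensive.

Import Order.TTheory GRing.Theory Num.Theory.
Import numFieldNormedType.Exports.

Local Open Scope classical_set_scope.
Local Open Scope ring_scope.

(* Self-loops are not excluded; they cancel in the Laplacian. *)
Record wdigraph (R : realType) (n : nat) := WDigraph {
  edge : rel 'I_n;
  adj : 'M[R]_n;
  adj_gt0 : forall i j, edge i j -> 0 < adj i j;
  adj_eq0 : forall i j, ~~ edge i j -> adj i j = 0 }.

Definition strongly_connected (R : realType) (n : nat) (G : wdigraph R n) :=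
  forall i j : 'I_n, i != j -> connect (edge G) i j.

Definition in_degree (R : realType) (n : nat) (G : wdigraph R n) (i : 'I_n) : R :=
  \sum_(j < n) adj G j i.

Definition laplacian (R : realType) (n : nat) (G : wdigraph R n) : 'M[R]_n :=
  diag_mx (\row_i in_degree G i) - adj G.

Definition ones (R : realType) (k : nat) : 'cV[R]_k := const_mx 1.
Arguments ones {R k}.

Definition diagc (R : realType) (k : nat) (w : 'cV[R]_k) : 'M[R]_k :=
  diag_mx w^T.

Definition null (R : realType) (k l : nat) (M : 'M[R]_(k, l)) : set 'cV[R]_l :=
  [set x | M *m x = 0].

(* Indices of R^(n*m) follow the Kronecker product [*t]: component [l] of
   block [i] is [mxtens_index (i, l)], i.e. position [i * m + l]. *)
Definition blkdiag (R : realType) (n m : nat) (A : 'I_n -> 'M[R]_m) :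
    'M[R]_(n * m) :=
  \matrix_(p, q)
    if (mxtens_unindex p).1 == (mxtens_unindex q).1
    then A (mxtens_unindex p).1 (mxtens_unindex p).2 (mxtens_unindex q).2
    else 0.

Definition stack (R : realType) (n m : nat) (b : 'I_n -> 'cV[R]_m) :
    'cV[R]_(n * m) :=
  \col_p b (mxtens_unindex p).1 (mxtens_unindex p).2 0.

(* [w] tensored with [x]; the library's [w *t x] has [1 * 1] columns, which is
   convertible to [1]. *)
Definition tensc (R : realType) (n m : nat) (w : 'cV[R]_n) (x : 'cV[R]_m) :
    'cV[R]_(n * m) :=
  w *t x.

(* The number of columns is left as [1 * m], as computed by [*t]. *)
Definition Umx (R : realType) (n m : nat) : 'M[R]_(n * m, 1 * m) :=
  ones *t 1%:M.
Arguments Umx {R n m}.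

(* Applied to symmetric matrices only. The spectrum is finite, so [sup] and
   [inf] are a maximum and a minimum whenever the set is nonempty. *)
Definition lambda_max (R : realType) (k : nat) (M : 'M[R]_k) : R :=
  sup [set a | eigenvalue M a].

Definition lambda2 (R : realType) (k : nat) (M : 'M[R]_k) : R :=
  inf [set a | eigenvalue M a /\ a != 0].

Definition Q11 (R : realType) (n m : nat) (L : 'M[R]_n)
    (A : 'I_n -> 'M[R]_m) (vbar : 'cV[R]_n) (alpha beta : R) :
    'M[R]_(n * m) :=
  let bL := L *t 1%:M in
  let bA := blkdiag A in
  let bV := diagc (tensc vbar ones) in
  (2^-1 * alpha) *: (bL *m bV + bV *m bL^T)
  + beta *: (bA^T *m Umx *m Umx^T *m bA).

Definition Q12 (R : realType) (n m : nat) (L : 'M[R]_n)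
    (A : 'I_n -> 'M[R]_m) (vbar : 'cV[R]_n) (alpha beta : R) :
    'M[R]_(n * m) :=
  let bL := L *t 1%:M in
  let bA := blkdiag A in
  let bV := diagc (tensc vbar ones) in
  2^-1 *: ((n%:R * beta) *: bA^T + alpha *: (bV *m bL^T *m bA^T)
           + beta *: (bA^T *m Umx *m Umx^T *m bA *m bA^T)).

Definition gamma_bar (R : realType) (n m : nat) (L : 'M[R]_n)
    (A : 'I_n -> 'M[R]_m) (vbar : 'cV[R]_n) (alpha beta : R) : R :=
  let bA := blkdiag A in
  let Vbar := diagc vbar in
  let q11 := Q11 L A vbar alpha beta in
  let q12 := Q12 L A vbar alpha beta in
  Num.max
    (2 / lambda2 (L *m Vbar + Vbar *m L^T)
     * lambda_max ((lambda2 q11)^-1 *: (q12^T *m q12)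
                   - (n%:R * beta) *: (bA *m bA^T)))
    0.

(* Derivative relative to the half-line [0 <= t]: two-sided for [0 < t],
   one-sided at [t = 0]. Values of [z] at negative times are irrelevant. *)
Definition has_deriv_nonneg (R : realType) (k : nat) (z dz : R -> 'cV[R]_k) :=
  forall t : R, 0 <= t ->
    h^-1 *: (z (t + h) - z t) @[h --> within [set h | 0 <= t + h] 0^'] --> dz t.

Definition euclidean_norm (R : realType) (k : nat) (z : 'cV[R]_k) : R :=
  Num.sqrt (\sum_(i < k) z i 0 ^+ 2).

Definition converges_exponentially (R : realType) (k : nat)
    (z : R -> 'cV[R]_k) (zstar : 'cV[R]_k) :=
  exists C mu : R, [/\ 0 < C, 0 < mu &
    forall t : R, 0 <= t ->
      euclidean_norm (z t - zstar) <= C * expR (- mu * t)].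

(* Main.v *)
Require Import Defs.
From HB Require Import structures.
From mathcomp Require Import all_boot all_order all_algebra.
From mathcomp Require Import mxtens ring lra.
From mathcomp Require Import all_classical all_reals all_analysis.

Set Implicit Arguments.
Unset Strict Implicit.
Unset Printing Implicit Defensive.

Import Order.TTheory GRing.Theory Num.Theory.
Import numFieldNormedType.Exports.

Local Open Scope classical_set_scope.
Local Open Scope ring_scope.

(** The weights and the states are decoupled: [v] solves an autonomous linear
    system, and the equations for [x] and [y] are linear with coefficients that
    depend on [v] only.  Write [bL], [bA], [bV] for the matrices of order [n * m]
    built from the Laplacian [L], the blocks [A i] and the limit weights [vbar],
    and [J] for [Umx *m Umx^T], which replaces each block by the sum of all blocks.

    Graph part.  As [L *m vbar = 0] and the columns of [L] sum to [0], the matrix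
    [N = L *m diagc vbar] has zero row and column sums, so that [s^T N s] is half
    of [\sum_i \sum_j adj i j * vbar j * (s i - s j)^2].  Strong connectivity
    makes constants the only zeros of this form, and [N + N^T] has a positive
    [lambda2].  With the Lyapunov function [\sum_p e_p^2 / vbar_p] for the error
    [e = v - vbar], this gives the convergence of the weights
    ([weights_converge]).

    State part.  Two linear quantities are constant along a trajectory.  The block
    sum of [y - bA x] is constant because [bL] has zero column sums, so that
    [J y = J bA (x - X)] for [X = tensc ones xstar] with [xstar] a solution of the
    summed equation.  The component of [x] in the kernel of [Q11] is constant
    because that kernel consists of stacked copies of vectors killed by every
    [A i]; the solution [xstar] is chosen so that [x - X] starts, hence stays,
    orthogonal to this kernel ([exists_equilibrium]).  Let [p] be [y] minus the
    mean of its blocks.  The derivative of [|x - X|^2 + |p|^2] is [-2] times a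
    quadratic form in [(x - X, p)] with blocks [Q11], [Q12] and
    [n beta bA bA^T + gamma N], up to terms proportional to the weight error
    ([energy_balance]).  Completing the square in [x - X], which [Q11] controls
    off its kernel, shows that [gamma > gamma_bar] is what makes the form coercive
    ([dissipation_coercive]).  An inequality of Gronwall type absorbs the
    exponentially small perturbation ([perturbed_gronwall]).

    The spectral quantities enter through variational bounds: the minimum of a
    Rayleigh quotient over the unit sphere of an invariant subspace is attained,
    by compactness, and is an eigenvalue. *)

(** * Dot product and spectral bounds *)

Definition dotv (R : realType) (k : nat) (u v : 'cV[R]_k) : R :=
  \sum_(i < k) u i 0 * v i 0.

Section DotProduct.
Variables (R : realType) (k : nat).
Implicit Types (u v w : 'cV[R]_k) (a : R).

Lemma dotvE u v : dotv u v = (u^T *m v) 0 0.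
Proof. by rewrite mxE; apply: eq_bigr => i _; rewrite mxE. Qed.

Lemma dotvC u v : dotv u v = dotv v u.
Proof. by apply: eq_bigr => i _; rewrite mulrC. Qed.

Lemma dotvDr u v w : dotv u (v + w) = dotv u v + dotv u w.
Proof.
by rewrite /dotv -big_split; apply: eq_bigr => i _; rewrite mxE mulrDr.
Qed.

Lemma dotvDl u v w : dotv (v + w) u = dotv v u + dotv w u.
Proof. by rewrite dotvC dotvDr !(dotvC u). Qed.

Lemma dotvZr a u v : dotv u (a *: v) = a * dotv u v.
Proof. by rewrite /dotv mulr_sumr; apply: eq_bigr => i _; rewrite mxE mulrCA. Qed.

Lemma dotvZl a u v : dotv (a *: u) v = a * dotv u v.
Proof. by rewrite dotvC dotvZr dotvC. Qed.

Lemma dotvNr u v : dotv u (- v) = - dotv u v.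
Proof. by rewrite -scaleN1r dotvZr mulN1r. Qed.

Lemma dotvNl u v : dotv (- u) v = - dotv u v.
Proof. by rewrite dotvC dotvNr dotvC. Qed.

Lemma dotvBr u v w : dotv u (v - w) = dotv u v - dotv u w.
Proof. by rewrite dotvDr dotvNr. Qed.

Lemma dotv0r u : dotv u 0 = 0.
Proof. by apply: big1 => i _; rewrite mxE mulr0. Qed.

Lemma dotvv_ge0 u : 0 <= dotv u u.
Proof. by apply: sumr_ge0 => i _; rewrite -expr2 sqr_ge0. Qed.

Lemma dotvv_eq0 u : dotv u u = 0 -> u = 0.
Proof.
move=> /eqP; rewrite psumr_eq0 => [/allP u0|i _]; last by rewrite -expr2 sqr_ge0.
apply/colP => i; rewrite mxE; apply/eqP.
by move: (u0 i (mem_index_enum _)); rewrite -expr2 sqrf_eq0.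
Qed.

Lemma dotvv_gt0 u : u != 0 -> 0 < dotv u u.
Proof.
move=> u0; rewrite lt_neqAle dotvv_ge0 andbT eq_sym.
by apply: contra_neq u0; exact: dotvv_eq0.
Qed.

Lemma coord_sqr_le u i : u i 0 ^+ 2 <= dotv u u.
Proof.
rewrite /dotv (bigD1 i) //= -expr2 lerDl.
by apply: sumr_ge0 => j _; rewrite -expr2 sqr_ge0.
Qed.

Lemma dotv_sqrD_le u v : dotv (u + v) (u + v) <= 2 * (dotv u u + dotv v v).
Proof.
have := dotvv_ge0 (u - v).
by rewrite !(dotvDl, dotvDr, dotvNl, dotvNr) (dotvC v u); lra.
Qed.

End DotProduct.

Lemma dotv_mulmxr (R : realType) (k l : nat) (M : 'M[R]_(k, l)) u v :
  dotv u (M *m v) = dotv (M^T *m u) v.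
Proof. by rewrite !dotvE trmx_mul trmxK mulmxA. Qed.

Lemma dotv_mulmxl (R : realType) (k l : nat) (M : 'M[R]_(k, l)) u v :
  dotv (M *m v) u = dotv v (M^T *m u).
Proof. by rewrite dotv_mulmxr trmxK. Qed.

Lemma gram_difference_sym (R : realType) (k : nat) (X Y : 'M[R]_k) (a b : R) :
  (a *: (X^T *m X) - b *: (Y *m Y^T))^T = a *: (X^T *m X) - b *: (Y *m Y^T).
Proof. by rewrite linearB !linearZ /= !trmx_mul !trmxK. Qed.

Lemma dotv_gram (R : realType) (k l : nat) (X : 'M[R]_(l, k)) (y : 'cV[R]_k) :
  dotv y (X^T *m X *m y) = dotv (X *m y) (X *m y).
Proof. by rewrite -mulmxA dotv_mulmxr trmxK. Qed.

Lemma dotv_cogram (R : realType) (k l : nat) (X : 'M[R]_(k, l)) (y : 'cV[R]_k) :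
  dotv y (X *m X^T *m y) = dotv (X^T *m y) (X^T *m y).
Proof. by rewrite -mulmxA dotv_mulmxr. Qed.

Lemma dotv_col_mx (R : realType) (k l : nat) (u u' : 'cV[R]_k) (w w' : 'cV[R]_l) :
  dotv (col_mx u w) (col_mx u' w') = dotv u u' + dotv w w'.
Proof. by rewrite !dotvE tr_col_mx mul_row_col mxE. Qed.

Lemma mulmx_coord_continuous (R : realType) (k l : nat) (M : 'M[R]_(l, k)) i :
  continuous (fun u : 'rV[R]_k => (M *m u^T) i 0).
Proof.
have -> : (fun u : 'rV[R]_k => (M *m u^T) i 0) =
          (fun u => \sum_(j < k) M i j * u 0 j).
  by apply/funext => u; rewrite mxE; apply: eq_bigr => j _; rewrite mxE.
apply: continuous_big => [|j _]; first exact: add_continuous.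
move=> u; apply: continuousM; [exact: cst_continuous|exact: coord_continuous].
Qed.

Lemma quadratic_form_continuous (R : realType) (k : nat) (M : 'M[R]_k) :
  continuous (fun u : 'rV[R]_k => dotv u^T (M *m u^T)).
Proof.
apply: continuous_big => [|j _]; first exact: add_continuous.
move=> u; apply: continuousM; last exact: mulmx_coord_continuous.
rewrite (_ : (fun u : 'rV[R]_k => u^T j 0) = fun u => u 0 j).
  exact: coord_continuous.
by apply/funext => w; rewrite mxE.
Qed.

(** The unit sphere of the kernel of [B] is compact, so the quadratic form
    attains its minimum there; homogeneity extends the bound to the kernel. *)
Lemma exists_rayleigh_minimizer (R : realType) (k l : nat) (M : 'M[R]_k)
    (B : 'M[R]_(l, k)) (w : 'cV[R]_k) :
  w != 0 -> B *m w = 0 ->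
  exists u : 'cV[R]_k, [/\ dotv u u = 1, B *m u = 0 &
    forall x : 'cV[R]_k, B *m x = 0 -> dotv u (M *m u) * dotv x x <= dotv x (M *m x)].
Proof.
move=> w0 Bw0.
pose S := [set u : 'rV[R]_k | dotv u^T (1%:M *m u^T) = 1 /\
                             forall i, (B *m u^T) i 0 = 0].
pose unitize (x : 'cV[R]_k) := (Num.sqrt (dotv x x))^-1 *: x^T.
have unitizeT x : (unitize x)^T = (Num.sqrt (dotv x x))^-1 *: x.
  by rewrite /unitize linearZ /= trmxK.
have sqrt_neq0 (x : 'cV[R]_k) : x != 0 -> Num.sqrt (dotv x x) != 0.
  by move=> x0; rewrite gt_eqF // sqrtr_gt0 dotvv_gt0.
have unitizeS x : x != 0 -> B *m x = 0 -> S (unitize x).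
  move=> x0 Bx; split; last by move=> i; rewrite unitizeT -scalemxAr Bx scaler0 mxE.
  rewrite mul1mx unitizeT dotvZl dotvZr mulrA -{3}(sqr_sqrtr (dotvv_ge0 x)).
  by have s0 := sqrt_neq0 _ x0; field.
have S_closed : closed S.
  have -> : S = [set u | dotv u^T (1%:M *m u^T) = 1] `&`
                \bigcap_(i in [set: 'I_l]) [set u : 'rV[R]_k | (B *m u^T) i 0 = 0].
    apply/seteqP; split=> [u [u1 Bu]|u [u1 Bu]]; split=> // i.
      by move=> _; exact: Bu.
    exact: Bu.
  apply: closedI.
    apply: (@closed_comp _ _ (fun u : 'rV[R]_k => dotv u^T (1%:M *m u^T)) [set x | x = 1]).
      by move=> u _; exact: quadratic_form_continuous.
    exact: closed_eq.
  apply: closed_bigI => i _.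
  apply: (@closed_comp _ _ (fun u : 'rV[R]_k => (B *m u^T) i 0) [set x | x = 0]).
    by move=> u _; exact: mulmx_coord_continuous.
  exact: closed_eq.
have S_compact : compact S.
  apply: (@subclosed_compact _ _
    [set u : 'rV[R]_k | forall i, `[(-1 : R), 1]%classic (u ord0 i)]) => //.
    by apply: (@rV_compact R k (fun=> `[(-1 : R), 1]%classic)) => i; exact: segment_compact.
  move=> u [u1 _] i /=; rewrite in_itv /= -ler_norml.
  have := coord_sqr_le u^T i; rewrite mul1mx in u1; rewrite u1 mxE.
  by rewrite -[X in _ <= X](expr1n _ 2) -real_normK ?num_real// ler_pXn2r ?nnegrE.
have Sn0 : S !=set0 by exists (unitize w); exact: unitizeS.
have S_cont : {within S, continuous (fun u : 'rV[R]_k => dotv u^T (M *m u^T))}.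
  by apply: continuous_subspaceT; exact: quadratic_form_continuous.
have [u /set_mem [uu Bu] umin] := EVT_min_rV Sn0 S_compact S_cont.
exists u^T; split.
- by rewrite mul1mx in uu.
- by apply/colP => i; rewrite Bu mxE.
move=> x Bx; have [->|x0] := eqVneq x 0; first by rewrite mulmx0 !dotv0r mulr0.
have := umin _ (mem_set (unitizeS _ x0 Bx)); rewrite unitizeT -scalemxAr dotvZl dotvZr mulrA.
rewrite -{3}(sqr_sqrtr (dotvv_ge0 x)).
have s0 := sqrt_neq0 _ x0.
have s1 : 0 < Num.sqrt (dotv x x) by rewrite lt_neqAle eq_sym s0 sqrtr_ge0.
move=> h; rewrite -ler_pdivlMr ?exprn_gt0//.
apply: (le_trans h); rewrite mulrC expr2 invfM //.
Qed.

(** First-order optimality: the residual [r = M u - a u] lies in the invariant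
    subspace and is orthogonal to [u], so moving from [u] by [s r] changes the
    gap between the two sides of the bound by [2 s |r|^2 + s^2 q], which can
    stay nonnegative for small negative [s] only if [r = 0]. *)
Lemma rayleigh_minimizer_eigenvector (R : realType) (k l : nat) (M : 'M[R]_k)
    (B : 'M[R]_(l, k)) (u : 'cV[R]_k) :
  M^T = M ->
  B *m u = 0 -> dotv u u = 1 ->
  (forall x : 'cV[R]_k, B *m x = 0 -> B *m (M *m x) = 0) ->
  (forall x : 'cV[R]_k, B *m x = 0 -> dotv u (M *m u) * dotv x x <= dotv x (M *m x)) ->
  M *m u = dotv u (M *m u) *: u.
Proof.
move=> M_sym Bu uu B_inv u_min; set a := dotv u (M *m u).
pose r := M *m u - a *: u.
have Br : B *m r = 0 by rewrite mulmxBr B_inv // -scalemxAr Bu scaler0 subr0.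
have ur : dotv u r = 0 by rewrite dotvBr dotvZr uu mulr1 subrr.
have ruE : dotv r (M *m u) = dotv r r.
  by rewrite {3}/r dotvBr dotvZr (dotvC r u) ur mulr0 subr0.
have uMr : dotv u (M *m r) = dotv r r.
  by rewrite dotv_mulmxr M_sym dotvC ruE.
have r_eq0 : r = 0 -> M *m u = a *: u by move=> /eqP; rewrite subr_eq0 => /eqP.
clearbody r.
pose q := dotv r (M *m r) - a * dotv r r.
have quad s : 0 <= 2 * s * dotv r r + s ^+ 2 * q.
  have := u_min (u + s *: r); rewrite mulmxDr -scalemxAr Bu Br scaler0 addr0.
  move=> /(_ erefl); rewrite mulmxDr -!scalemxAr !(dotvDl, dotvDr, dotvZl, dotvZr).
  by rewrite ruE uMr (dotvC r u) ur uu -/a /q; lra.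
apply/r_eq0/dotvv_eq0.
have rr := dotvv_ge0 r.
have qq : q <= `|q| by exact: ler_norm.
have q0 : 0 <= `|q| by exact: normr_ge0.
(* This step length makes the quadratic term at most half of the linear one. *)
have := quad (- dotv r r / (1 + `|q|)).
have d0 : 0 < 1 + `|q| by lra.
set d := 1 + `|q| in d0 *; set g := dotv r r in rr *.
have -> : 2 * (- g / d) * g + (- g / d) ^+ 2 * q = (g / d) ^+ 2 * (q - 2 * d).
  by field; rewrite gt_eqF.
move=> h; have : (g / d) ^+ 2 <= 0.
  rewrite leNgt; apply/negP => gd; move: h; rewrite pmulr_rge0 // /d; lra.
rewrite le_eqVlt ltNge sqr_ge0 orbF sqrf_eq0 mulf_eq0 invr_eq0 (gt_eqF d0) orbF.
by move/eqP.
Qed.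

Section Spectrum.
Variables (R : realType) (k : nat) (M : 'M[R]_k).
Hypothesis M_sym : M^T = M.

Lemma eigenvalue_ex_col (a : R) :
  eigenvalue M a -> exists2 w : 'cV[R]_k, w != 0 & M *m w = a *: w.
Proof.
case/eigenvalueP => w wM w0; exists w^T; first by rewrite trmx_eq0.
by rewrite -{1}M_sym -trmx_mul wM linearZ.
Qed.

Lemma eigenvalue_col (a : R) (w : 'cV[R]_k) :
  w != 0 -> M *m w = a *: w -> eigenvalue M a.
Proof.
move=> w0 Mw; apply/eigenvalueP; exists w^T; last by rewrite trmx_eq0.
by rewrite -{1}M_sym -trmx_mul Mw linearZ.
Qed.

(** The maximum of the Rayleigh quotient is an eigenvalue, and no eigenvalue
    exceeds it; both facts are needed, as [lambda_max] is a supremum and only a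
    bounded set has a meaningful one. *)
Lemma rayleigh_le_lambda_max (x : 'cV[R]_k) :
  dotv x (M *m x) <= lambda_max M * dotv x x.
Proof.
have [->|x0] := eqVneq x 0; first by rewrite mulmx0 !dotv0r mulr0.
have [u [uu _ u_max]] := exists_rayleigh_minimizer (- M) x0 (mul0mx 1 x).
have Mle y : dotv y (M *m y) <= dotv u (M *m u) * dotv y y.
  by have := u_max y (mul0mx _ _); rewrite !mulNmx !dotvNr mulNr lerN2.
have u0 : u != 0 by apply: contra_eq_neq uu => ->; rewrite dotv0r eq_sym oner_eq0.
have Mu : M *m u = dotv u (M *m u) *: u.
  apply: oppr_inj; rewrite -mulNmx -scaleNr -dotvNr -mulNmx.
  by apply: (rayleigh_minimizer_eigenvector _ (mul0mx 1 u) uu _ u_max) => [|y _];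
    [rewrite linearN /= M_sym|rewrite mul0mx].
apply: (le_trans (Mle x)); apply: ler_wpM2r; first exact: dotvv_ge0.
apply: ub_le_sup; last exact: eigenvalue_col u0 Mu.
exists (dotv u (M *m u)) => b /= /eigenvalue_ex_col [y y0 My].
by have := Mle y; rewrite {1}My dotvZr ler_pM2r // dotvv_gt0.
Qed.

(** For symmetric [M] the rows of [kermx M] span the kernel of [M], so
    [kermx M *m x = 0] says that [x] is orthogonal to that kernel. *)
Lemma ker_orthogonal (w x : 'cV[R]_k) :
  M *m w = 0 -> kermx M *m x = 0 -> dotv w x = 0.
Proof.
move=> Mw Kx; have /submxP[c wc] : (w^T <= kermx M)%MS.
  by apply/sub_kermxP; rewrite -{1}M_sym -trmx_mul Mw trmx0.
by rewrite dotvE wc -mulmxA Kx mulmx0 mxE.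
Qed.

(** The orthogonal complement of the kernel is [M]-invariant, and the Rayleigh
    quotient cannot vanish at its minimizer, which would then be in the kernel. *)
Lemma ker_complement_gap (w : 'cV[R]_k) : M *m w != 0 ->
  (forall x : 'cV[R]_k, 0 <= dotv x (M *m x)) ->
  exists2 a, 0 < a /\ eigenvalue M a &
    forall x : 'cV[R]_k, kermx M *m x = 0 -> a * dotv x x <= dotv x (M *m x).
Proof.
move=> Mw0 M_ge0.
have BMx (x : 'cV[R]_k) : kermx M *m (M *m x) = 0 by rewrite mulmxA mulmx_ker mul0mx.
have [u [uu Bu u_min]] := exists_rayleigh_minimizer M Mw0 (BMx w).
have u0 : u != 0 by apply: contra_eq_neq uu => ->; rewrite dotv0r eq_sym oner_eq0.
have Mu := rayleigh_minimizer_eigenvector M_sym Bu uu (fun x _ => BMx x) u_min.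
exists (dotv u (M *m u)) => //; split; last exact: eigenvalue_col Mu.
rewrite lt_neqAle M_ge0 andbT eq_sym; apply/eqP => a0.
move: Mu; rewrite a0 scale0r => Mu; have := ker_orthogonal Mu Bu.
by rewrite uu => /eqP; rewrite oner_eq0.
Qed.

(** An eigenvector for a nonzero eigenvalue is orthogonal to the kernel, so the
    least Rayleigh quotient on the complement of the kernel is the least nonzero
    eigenvalue.  If [M = 0] there is no such eigenvalue, and the bound only
    concerns [x = 0]. *)
Lemma lambda2_gap : (forall x : 'cV[R]_k, 0 <= dotv x (M *m x)) ->
  (M != 0 -> 0 < lambda2 M) /\
  forall x : 'cV[R]_k, kermx M *m x = 0 -> lambda2 M * dotv x x <= dotv x (M *m x).
Proof.
move=> M_ge0; have [M0|M0] := eqVneq M 0.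
  split=> [|x Kx]; first by [].
  have Mx : M *m x = 0 by rewrite M0 mul0mx.
  by rewrite Mx dotv0r (ker_orthogonal Mx Kx) mulr0.
have [w Mw0] : exists w : 'cV[R]_k, M *m w != 0.
  apply: contrapT => /forallNP Mw; move/eqP: M0; apply; apply/matrixP => i j.
  have := Mw (delta_mx j 0); rewrite -colE => /negP; rewrite negbK => /eqP/colP/(_ i).
  by rewrite !mxE.
have [a [a0 aM] a_gap] := ker_complement_gap Mw0 M_ge0.
have a_lb : lbound [set b | eigenvalue M b /\ b != 0] a.
  move=> b /= [/eigenvalue_ex_col [v v0 Mv] b0].
  have Kv : kermx M *m v = 0.
    by rewrite -[v](scalerK b0) -Mv -scalemxAr mulmxA mulmx_ker mul0mx scaler0.
  by have := a_gap v Kv; rewrite Mv dotvZr ler_pM2r // dotvv_gt0.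
have a_in : [set b | eigenvalue M b /\ b != 0] a by split=> //; rewrite gt_eqF.
have -> : lambda2 M = a.
  apply/eqP; rewrite eq_le; apply/andP; split.
    by apply: ge_inf => //; exists a.
  by apply: lb_le_inf => //; exists a.
by split.
Qed.
End Spectrum.

Lemma mulmx_dotv_bound (R : realType) (k l : nat) (M : 'M[R]_(l, k)) :
  exists2 B : R, 0 <= B & forall x : 'cV[R]_k, dotv (M *m x) (M *m x) <= B * dotv x x.
Proof.
exists (Num.max 0 (lambda_max (M^T *m M))); first by rewrite le_max lexx.
move=> x; rewrite dotv_mulmxl mulmxA.
have MtM_sym : (M^T *m M)^T = M^T *m M by rewrite trmx_mul trmxK.
apply: le_trans (rayleigh_le_lambda_max MtM_sym x) _.
by rewrite ler_wpM2r ?dotvv_ge0 // le_max lexx orbT.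
Qed.

Lemma diagcD (R : realType) (k : nat) (u w : 'cV[R]_k) : diagc (u + w) = diagc u + diagc w.
Proof. by rewrite /diagc !linearD. Qed.

Lemma diagcE (R : realType) (k : nat) (w u : 'cV[R]_k) p :
  (diagc w *m u) p 0 = w p 0 * u p 0.
Proof. by rewrite /diagc mul_diag_mx !mxE. Qed.

(** Used with [e] the error of the weights: the perturbation of the dynamics
    that it causes is at most proportional to its size. *)
Lemma dotv_diagc_bound (R : realType) (k l : nat) (M : 'M[R]_(l, k)) :
  exists2 B : R, 0 <= B & forall (u : 'cV[R]_l) (e w : 'cV[R]_k) (eps : R), 0 < eps ->
    (forall p, `|e p 0| <= eps) ->
    `|dotv u (M *m (diagc e *m w))| <= B * eps * (dotv u u + dotv w w).
Proof.
have [B B_ge0 M_le] := mulmx_dotv_bound M; exists (1 + B); first by lra.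
move=> u e w eps eps_gt0 e_le; set g := diagc e *m w.
have gg : dotv g g <= eps ^+ 2 * dotv w w.
  rewrite /dotv mulr_sumr; apply: ler_sum => p _.
  rewrite diagcE mulrACA -!expr2 ler_wpM2r ?sqr_ge0 //.
  by rewrite -(real_normK (num_real (e p 0))) ler_pXn2r ?nnegrE // ltW.
have Mg : dotv (M *m g) (M *m g) <= B * (eps ^+ 2 * dotv w w).
  by apply: le_trans (M_le g) _; exact: ler_wpM2l.
have := dotvv_ge0 (eps *: u + M *m g); have := dotvv_ge0 (eps *: u - M *m g).
rewrite !(dotvDl, dotvDr, dotvNl, dotvNr, dotvZl, dotvZr) (dotvC (M *m g) u).
set a := dotv u (M *m g); set b := dotv (M *m g) _ in Mg *.
move=> h1 h2.
have uu := dotvv_ge0 u; have ww := dotvv_ge0 w.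
rewrite ler_norml; apply/andP; split; rewrite -(ler_pM2l eps_gt0).
  have : 0 <= eps ^+ 2 * (B * dotv u u + dotv w w).
    by rewrite mulr_ge0 ?sqr_ge0 // addr_ge0 // mulr_ge0.
  have : 0 <= eps ^+ 2 * (dotv u u + B * dotv w w).
    by rewrite mulr_ge0 ?sqr_ge0 // addr_ge0 // mulr_ge0.
  move: (dotv u u) (dotv w w) a b h1 h2 Mg => *; lra.
have : 0 <= eps ^+ 2 * (B * dotv u u + dotv w w).
  by rewrite mulr_ge0 ?sqr_ge0 // addr_ge0 // mulr_ge0.
have : 0 <= eps ^+ 2 * (dotv u u + B * dotv w w).
  by rewrite mulr_ge0 ?sqr_ge0 // addr_ge0 // mulr_ge0.
move: (dotv u u) (dotv w w) a b h1 h2 Mg => *; lra.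
Qed.

(** Normal equations: they are solvable because [K] and [K *m K^T] have the
    same left kernel over the reals. *)
Lemma orthogonal_projection_on_rows (R : realType) (k l : nat) (K : 'M[R]_(l, k)) (x : 'cV[R]_k) :
  exists c, K *m (K^T *m c) = K *m x.
Proof.
have : ((K *m x)^T <= K *m K^T)%MS.
  rewrite submxE trmx_mul -mulmxA; set C := cokermx _.
  have KC : K *m K^T *m C = 0 by exact: mulmx_coker.
  clearbody C.
  suff -> : K^T *m C = 0 by rewrite mulmx0.
  apply/matrixP => i j; rewrite [RHS]mxE.
  have : K^T *m col j C = 0.
    apply: dotvv_eq0; rewrite dotv_mulmxr trmxK colE !mulmxA KC.
    by rewrite mul0mx dotvC dotv0r.
  by move=> /colP/(_ i); rewrite colE mulmxA -colE !mxE.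
case/submxP => c cE; exists c^T; apply: trmx_inj.
by rewrite mulmxA trmx_mul trmxK trmx_mul trmxK cE.
Qed.

(** * Calculus on the half-line *)

(** Solutions are differentiable on the half-line only; of the one-sided
    derivative at [0] the monotonicity argument retains right continuity. *)
Definition halfline_deriv (R : realType) (f df : R -> R) :=
  f t @[t --> 0^'+] --> f 0 /\ forall t : R, 0 < t -> is_derive t 1 f (df t).

Lemma halfline_deriv_coord (R : realType) (k : nat) (z dz : R -> 'cV[R]_k) i :
  has_deriv_nonneg z dz ->
  halfline_deriv (fun t => z t i 0) (fun t => dz t i 0).
Proof.
move=> zP.
have zP_i t : 0 <= t ->
    h^-1 * (z (t + h) i 0 - z t i 0) @[h --> within [set h | 0 <= t + h] 0^'] --> dz t i 0.
  move=> t0;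
  have -> : (fun h => h^-1 * (z (t + h) i 0 - z t i 0)) =
            (fun M : 'cV[R]_k => M i 0) \o (fun h => h^-1 *: (z (t + h) - z t)).
    by apply/funext => h; rewrite /= !mxE.
  by apply: continuous_cvg (zP t t0); exact: coord_continuous.
split=> [|t t_gt0].
  have : h * (h^-1 * (z h i 0 - z 0 i 0)) + z 0 i 0 @[h --> 0^'+] --> 0 * dz 0 i 0 + z 0 i 0.
    apply: cvgD; last exact: cvg_cst.
    apply: cvgM; first exact: cvg_at_right_filter cvg_id.
    have := zP_i 0 (lexx _); under eq_fun do rewrite add0r.
    move=> h0P; apply: cvg_trans h0P; apply: cvg_app => P; rewrite /at_right /dnbhs /within.
    apply: (@filterS _ (nbhs (0 : R))) => h hP h_gt0; apply: hP; first by rewrite gt_eqF.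
    by rewrite /= add0r ltW.
  rewrite mul0r add0r => h0P; apply: cvg_trans h0P; apply: near_eq_cvg; near=> h.
  have h0 : h != 0 by rewrite gt_eqF //; near: h; exact: nbhs_right_gt.
  by rewrite mulrA divff // mul1r subrK.
have tP : h^-1 * (z (t + h) i 0 - z t i 0) @[h --> 0^'] --> dz t i 0.
  have htP := zP_i t (ltW t_gt0).
  have Dt : \forall h \near 0^', 0 <= t + h.
    apply: filterS (dnbhs0_le t_gt0) => h; rewrite ler_norml => /andP[ht _].
    by rewrite -lerBlDl sub0r.
  by apply: cvg_trans htP; apply: cvg_app => P; apply: filterS2 Dt => h Dh; apply.
have quotientE : (fun h => h^-1 * (z (t + h) i 0 - z t i 0)) =
    (fun h => h^-1 *: (((fun s => z s i 0) \o shift t) (h *: (1 : R)) - z t i 0)).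
  by apply/funext => h; rewrite /= [_%:A]mulr1 (addrC t).
rewrite quotientE in tP.
by split; [exact: cvgP tP | exact: cvg_lim tP].
Unshelve. all: by end_near.
Qed.

Section HalflineDeriv.
Variable R : realType.
Implicit Types (f g df dg : R -> R).

Lemma halfline_derivD f g df dg :
  halfline_deriv f df -> halfline_deriv g dg ->
  halfline_deriv (fun t => f t + g t) (fun t => df t + dg t).
Proof. by move=> [f0 fP] [g0 gP]; split=> [|t t0]; [exact: cvgD|apply: is_deriveD; auto]. Qed.

Lemma halfline_derivM f g df dg :
  halfline_deriv f df -> halfline_deriv g dg ->
  halfline_deriv (fun t => f t * g t) (fun t => df t * g t + f t * dg t).
Proof.
move=> [f0 fP] [g0 gP]; split=> [|t t0]; first exact: cvgM.
apply: is_derive_eq (is_deriveM (fP t t0) (gP t t0)) _.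
by rewrite addrC; congr (_ + _); rewrite mulrC.
Qed.

Lemma halfline_deriv_cst (a : R) : halfline_deriv (fun=> a) (fun=> 0).
Proof. by split=> [|t _]; [exact: cvg_cst|exact: is_derive_cst]. Qed.

Lemma halfline_derivZ (a : R) f df :
  halfline_deriv f df -> halfline_deriv (fun t => a * f t) (fun t => a * df t).
Proof.
move=> fP; have := halfline_derivM (halfline_deriv_cst a) fP.
by congr halfline_deriv; apply/funext => t; rewrite mul0r add0r.
Qed.

Lemma halfline_deriv_sum (I : Type) (r : seq I) (f df : I -> R -> R) :
  (forall i, halfline_deriv (f i) (df i)) ->
  halfline_deriv (fun t => \sum_(i <- r) f i t) (fun t => \sum_(i <- r) df i t).
Proof.
move=> fP; elim: r => [|i r IHr].
  under [X in halfline_deriv X]eq_fun do rewrite big_nil.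
  under [X in halfline_deriv _ X]eq_fun do rewrite big_nil.
  exact: halfline_deriv_cst.
under [X in halfline_deriv X]eq_fun do rewrite big_cons.
under [X in halfline_deriv _ X]eq_fun do rewrite big_cons.
exact: halfline_derivD.
Qed.

Lemma halfline_deriv_linear (a : R) : halfline_deriv (fun t => a * t) (fun=> a).
Proof.
rewrite -[X in halfline_deriv _ X](_ : (fun=> a * 1) = _); last first.
  by apply/funext => t; rewrite mulr1.
apply: halfline_derivZ; split=> [|t _]; last exact: is_derive_id.
exact: cvg_at_right_filter cvg_id.
Qed.

Lemma halfline_deriv_expR f df :
  halfline_deriv f df -> halfline_deriv (fun t => expR (f t)) (fun t => df t * expR (f t)).
Proof.
move=> [f0 fP]; split=> [|t t0].
  by apply: continuous_cvg f0; exact: continuous_expR.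
have := @is_derive1_comp R expR f t _ _ (is_derive_expR _) (fP t t0).
by rewrite mulrC.
Qed.

Lemma halfline_nonincreasing f df t :
  halfline_deriv f df -> (forall t : R, 0 < t -> df t <= 0) -> 0 <= t -> f t <= f 0.
Proof.
move=> [f0 fP] df_le0 t_ge0.
apply: (@ler0_derive1_nincry _ f 0) => // [s|s|].
- by rewrite in_itv /= andbT => /fP [].
- rewrite in_itv /= andbT => s0; rewrite derive1E.
  by have [_ ->] := fP s s0; exact: df_le0.
- apply/continuous_within_itvcyP; split=> // s.
  rewrite in_itv /= andbT => s0.
  by apply: differentiable_continuous; apply/derivable1_diffP; case: (fP s s0).
Qed.

End HalflineDeriv.

(** The term [k exp(-mu t) W] has a bounded effect, since its coefficient is
    integrable: multiplying [W] by the exponential of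
    [s t = (k / mu) exp(-mu t)], whose derivative is [- k exp(-mu t)], cancels
    it.  The remaining [k exp(-mu t)] is compensated by the second term of [Z]. *)
Lemma perturbed_gronwall (R : realType) (W dW : R -> R) (c mu k : R) :
  halfline_deriv W dW -> (forall t, 0 <= W t) -> 0 < c -> 0 < mu -> 0 <= k ->
  (forall t : R, 0 < t -> dW t <= - c * W t + k * expR (- mu * t) * (W t + 1)) ->
  exists C rho : R, [/\ 0 <= C, 0 < rho &
    forall t, 0 <= t -> W t <= C * expR (- rho * t)].
Proof.
move=> WP W_ge0 c_gt0 mu_gt0 k_ge0 dW_le.
(* Half of the smaller rate, to be strictly below [mu] and below [c]. *)
pose rho := Num.min c mu / 2.
have [rho_gt0 rho_le_c rho_lt_mu] : [/\ 0 < rho, rho <= c & rho < mu].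
  by rewrite /rho; split; have [?|?] := leP c mu; lra.
pose s t := k / mu * expR (- mu * t).
pose K := k * expR (k / mu) / (mu - rho).
pose Z t := W t * expR (rho * t + s t) + K * expR (- (mu - rho) * t).
have sP : halfline_deriv s (fun t => k / mu * (- mu * expR (- mu * t))).
  by apply: halfline_derivZ; apply: halfline_deriv_expR; exact: halfline_deriv_linear.
have ZP : halfline_deriv Z (fun t =>
    (dW t * expR (rho * t + s t)
     + W t * ((rho + k / mu * (- mu * expR (- mu * t))) * expR (rho * t + s t)))
    + K * (- (mu - rho) * expR (- (mu - rho) * t))).
  apply: halfline_derivD.
    apply: halfline_derivM => //; apply: halfline_deriv_expR.
    by apply: halfline_derivD sP; exact: halfline_deriv_linear.
  by apply: halfline_derivZ; apply: halfline_deriv_expR; exact: halfline_deriv_linear.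
have K_ge0 : 0 <= K by rewrite divr_ge0 ?mulr_ge0 ?expR_ge0 // subr_ge0 ltW.
have s_ge0 t : 0 <= s t by rewrite mulr_ge0 ?expR_ge0 // divr_ge0 // ltW.
have Z_noninc t : 0 <= t -> Z t <= Z 0.
  apply: halfline_nonincreasing ZP _ => {}t t_gt0.
  have s_le : s t <= k / mu.
    rewrite /s -[leRHS]mulr1; apply: ler_wpM2l; first by rewrite divr_ge0 // ltW.
    by rewrite -expR0 ler_expR mulNr oppr_le0 mulr_ge0 // ltW.
  set E := expR (rho * t + s t).
  have E_le : k * expR (- mu * t) * E <= K * (mu - rho) * expR (- (mu - rho) * t).
    rewrite /K divfK; last by rewrite subr_eq0 gt_eqF.
    rewrite -!mulrA; apply: ler_wpM2l => //.
    by rewrite /E -!expRD ler_expR; lra.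
  have E_gt0 : 0 < E by exact: expR_gt0.
  have -> : k / mu * (- mu * expR (- mu * t)) = - (k * expR (- mu * t)).
    by field; exact/lt0r_neq0.
  have := dW_le t t_gt0; set e := k * expR (- mu * t) in E_le *.
  move=> /(ler_wpM2r (ltW E_gt0)) dW_le'.
  have : 0 <= (c - rho) * (W t * E).
    by rewrite mulr_ge0 ?subr_ge0 // mulr_ge0 // ltW.
  set w := W t in dW_le' *; set d := dW t in dW_le' *.
  set F := expR (- (mu - rho) * t) in E_le *.
  by move: dW_le' E_le; clear; lra.
exists (Z 0), rho; split=> //.
  by apply: addr_ge0; apply: mulr_ge0 => //; exact: expR_ge0.
move=> t t_ge0; rewrite mulNr expRN ler_pdivlMr ?expR_gt0 //.
apply: le_trans (Z_noninc t t_ge0).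
rewrite /Z; apply: ler_wpDr; first by rewrite mulr_ge0 ?expR_ge0.
by apply: ler_wpM2l => //; rewrite ler_expR lerDl.
Qed.

Definition vec_deriv (R : realType) (k : nat) (z dz : R -> 'cV[R]_k) :=
  forall i, halfline_deriv (fun t => z t i 0) (fun t => dz t i 0).

Lemma has_deriv_nonneg_vec (R : realType) (k : nat) (z dz : R -> 'cV[R]_k) :
  has_deriv_nonneg z dz -> vec_deriv z dz.
Proof. by move=> zP i; exact: halfline_deriv_coord. Qed.

Section VectorDeriv.
Variables (R : realType) (k : nat).
Implicit Types z w dz dw : R -> 'cV[R]_k.

Lemma vec_derivD z w dz dw : vec_deriv z dz -> vec_deriv w dw ->
  vec_deriv (fun t => z t + w t) (fun t => dz t + dw t).
Proof.
move=> zP wP i; under [X in halfline_deriv X]eq_fun do rewrite mxE.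
by under [X in halfline_deriv _ X]eq_fun do rewrite mxE; exact: halfline_derivD.
Qed.

Lemma vec_deriv_cst (a : 'cV[R]_k) : vec_deriv (fun=> a) (fun=> 0).
Proof.
move=> i; under [X in halfline_deriv _ X]eq_fun do rewrite mxE.
exact: halfline_deriv_cst.
Qed.

Lemma vec_deriv_mulmx l (M : 'M[R]_(l, k)) z dz :
  vec_deriv z dz -> vec_deriv (fun t => M *m z t) (fun t => M *m dz t).
Proof.
move=> zP i; under [X in halfline_deriv X]eq_fun do rewrite mxE.
under [X in halfline_deriv _ X]eq_fun do rewrite mxE.
by apply: halfline_deriv_sum => j; exact: halfline_derivZ.
Qed.

Lemma vec_deriv_dotv z w dz dw : vec_deriv z dz -> vec_deriv w dw ->
  halfline_deriv (fun t => dotv (z t) (w t)) (fun t => dotv (dz t) (w t) + dotv (z t) (dw t)).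
Proof.
move=> zP wP; under [X in halfline_deriv _ X]eq_fun do rewrite -big_split /=.
by apply: halfline_deriv_sum => j; exact: halfline_derivM.
Qed.

Lemma vec_deriv0_cst z dz t :
  vec_deriv z dz -> (forall t, 0 < t -> dz t = 0) -> 0 <= t -> z t = z 0.
Proof.
move=> zP dz0 t_ge0; apply/colP => i; apply/eqP; rewrite eq_le; apply/andP; split.
  apply: halfline_nonincreasing (zP i) _ t_ge0 => s s_gt0.
  by rewrite dz0 // mxE.
have := halfline_derivZ (-1) (zP i).
move=> /halfline_nonincreasing/(_ _ t_ge0); rewrite !mulN1r lerN2; apply=> s s_gt0.
by rewrite dz0 // mxE mulr0.
Qed.

End VectorDeriv.

Lemma converges_exponentially_dotv (R : realType) (k : nat) (z : R -> 'cV[R]_k) zstar (C rho : R) :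
  0 <= C -> 0 < rho ->
  (forall t, 0 <= t -> dotv (z t - zstar) (z t - zstar) <= C * expR (- rho * t)) ->
  converges_exponentially z zstar.
Proof.
move=> C_ge0 rho_gt0 z_le; exists (C + 1), (rho / 2); split; [lra|lra|] => t t_ge0.
have -> : expR (- (rho / 2) * t) = Num.sqrt (expR (- rho * t)).
  rewrite (_ : - rho * t = - (rho / 2) * t + - (rho / 2) * t); last by field.
  by rewrite expRD -expr2 sqrtr_sqr ger0_norm // expR_ge0.
rewrite -[C + 1]ger0_norm; last by lra.
rewrite -sqrtr_sqr -sqrtrM ?sqr_ge0 //; apply: ler_wsqrtr.
apply: le_trans (z_le t t_ge0) _; apply: ler_wpM2r; first exact: expR_ge0.
nra.
Qed.

(** * The balanced Laplacian *)

Section LaplacianForm.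
Variables (R : realType) (n : nat) (G : wdigraph R n) (vbar : 'cV[R]_n).
Hypothesis Gsc : strongly_connected G.
Hypothesis vbar_ker : laplacian G *m vbar = 0.
Hypothesis vbar_gt0 : forall i, 0 < vbar i 0.
Hypothesis vbar_sum : \sum_(i < n) vbar i 0 = 1.

Definition balanced_laplacian : 'M[R]_n := laplacian G *m diagc vbar.
Let N := balanced_laplacian.
Let w i j := adj G i j * vbar j 0.

Lemma adj_ge0 i j : 0 <= adj G i j.
Proof.
by have [/adj_gt0/ltW//|/adj_eq0->] := boolP (edge G i j).
Qed.

Lemma ones_mul_laplacian (k : nat) : (const_mx 1 : 'M[R]_(k, n)) *m laplacian G = 0.
Proof.
apply/matrixP => i j; rewrite !mxE.
under eq_bigr do rewrite !mxE mul1r.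
rewrite sumrB (bigD1 j) //= eqxx mulr1n big1 ?addr0; last first.
  by move=> l /negbTE; rewrite eq_sym => ->; rewrite mulr0n.
by rewrite subrr.
Qed.

(** Scaling the columns by [vbar] balances the graph: the weights [w] have equal
    in- and out-degree at each node. *)
Lemma out_flow_eq_in_flow i : \sum_j w i j = in_degree G i * vbar i 0.
Proof.
move/colP/(_ i): vbar_ker; rewrite !mxE.
under eq_bigr do rewrite !mxE mulrBl.
rewrite sumrB (bigD1 i) //= eqxx mulr1n big1 ?addr0; last first.
  by move=> l /negbTE; rewrite eq_sym => ->; rewrite mulr0n mul0r.
by move/eqP; rewrite subr_eq0 => /eqP.
Qed.

Lemma balanced_laplacianE i j : N i j = (in_degree G i * vbar i 0) *+ (i == j) - w i j.
Proof.
rewrite /N /balanced_laplacian /diagc mul_mx_diag !mxE mulrBl; congr (_ - _).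
by case: eqP => [->|_]; rewrite ?mulr1n ?mulr0n ?mul0r.
Qed.

(** Expanding the square gives the out-degree and the in-degree terms, which
    agree by balance. *)
Lemma dotv_balanced_laplacian (s : 'cV[R]_n) :
  2 * dotv s (N *m s) = \sum_i \sum_j w i j * (s i 0 - s j 0) ^+ 2.
Proof.
have rowE i : \sum_j w i j * s i 0 ^+ 2 = in_degree G i * vbar i 0 * s i 0 ^+ 2.
  by rewrite -mulr_suml out_flow_eq_in_flow.
have colE j : \sum_i w i j * s j 0 ^+ 2 = in_degree G j * vbar j 0 * s j 0 ^+ 2.
  by rewrite -!mulr_suml.
have NsE : dotv s (N *m s) = \sum_i in_degree G i * vbar i 0 * s i 0 ^+ 2
    - \sum_i \sum_j w i j * s i 0 * s j 0.
  rewrite /dotv -sumrB; apply: eq_bigr => i _; rewrite mxE.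
  under eq_bigr do rewrite balanced_laplacianE mulrBl.
  rewrite sumrB (bigD1 i) //= eqxx mulr1n big1 ?addr0; last first.
    by move=> l /negbTE; rewrite eq_sym => ->; rewrite mulr0n mul0r.
  rewrite mulrBr mulr_sumr; congr (_ - _); first by ring.
  by apply: eq_bigr => j _; ring.
have -> : \sum_i \sum_j w i j * (s i 0 - s j 0) ^+ 2 =
    \sum_i \sum_j w i j * s i 0 ^+ 2 + \sum_i \sum_j w i j * s j 0 ^+ 2
    - 2 * \sum_i \sum_j w i j * s i 0 * s j 0.
  rewrite mulr_sumr -big_split -sumrB; apply: eq_bigr => i _ /=.
  rewrite mulr_sumr -big_split -sumrB; apply: eq_bigr => j _ /=; ring.
rewrite [X in _ + X - _]exchange_big /= (eq_bigr _ (fun i _ => rowE i)).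
by rewrite (eq_bigr _ (fun j _ => colE j)) NsE; ring.
Qed.

Lemma balanced_laplacian_ge0 (s : 'cV[R]_n) : 0 <= dotv s (N *m s).
Proof.
rewrite -(pmulr_rge0 _ (ltr0n R 2)) dotv_balanced_laplacian.
apply: sumr_ge0 => i _; apply: sumr_ge0 => j _.
by rewrite mulr_ge0 ?sqr_ge0 // mulr_ge0 ?adj_ge0 // ltW.
Qed.

(** Every term of the sum of squares vanishes, so [s] agrees at the ends of each
    edge, hence along each path. *)
Lemma balanced_laplacian_ker (s : 'cV[R]_n) :
  dotv s (N *m s) = 0 -> forall i j, s i 0 = s j 0.
Proof.
move=> s0; have := dotv_balanced_laplacian s; rewrite s0 mulr0.
have term_ge0 i j : 0 <= w i j * (s i 0 - s j 0) ^+ 2.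
  by rewrite mulr_ge0 ?sqr_ge0 // mulr_ge0 ?adj_ge0 // ltW.
move=> /esym/eqP; rewrite psumr_eq0 => [/allP s_edge|i _]; last exact: sumr_ge0.
have edge_eq i j : edge G i j -> s i 0 = s j 0.
  move=> /adj_gt0 aij; have := s_edge i (mem_index_enum _); rewrite psumr_eq0 //=.
  move=> /allP/(_ j (mem_index_enum _)); rewrite /= mulf_eq0 sqrf_eq0 subr_eq0.
  by rewrite gt_eqF ?mulr_gt0 //= => /eqP.
move=> i j; have [->//|/Gsc/connectP[p ep ->]] := eqVneq i j.
elim: p i ep => //= k p IHp i /andP[/edge_eq -> ep].
exact: IHp.
Qed.

Let M := N + N^T.

Lemma dotv_symmetrized (s : 'cV[R]_n) : dotv s (M *m s) = 2 * dotv s (N *m s).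
Proof.
by rewrite mulmxDl dotvDr (dotv_mulmxr N^T) trmxK (dotvC (N *m s)) mulr_natl mulr2n.
Qed.

Lemma symmetrized_sym : M^T = M.
Proof. by rewrite linearD /= trmxK addrC. Qed.

Lemma symmetrized_ge0 (s : 'cV[R]_n) : 0 <= dotv s (M *m s).
Proof. by rewrite dotv_symmetrized mulr_ge0 // balanced_laplacian_ge0. Qed.

Lemma symmetrized_lambda2_gt0 : (2 <= n)%N -> 0 < lambda2 M.
Proof.
move=> n2; have [+ _] := lambda2_gap symmetrized_sym symmetrized_ge0; apply.
apply/eqP => M0.
have i0 : 'I_n by exact: Ordinal (ltnW n2).
pose e : 'cV[R]_n := \col_i (i == Ordinal (ltnW n2))%:R.
have := dotv_symmetrized e; rewrite M0 mul0mx dotv0r => /esym/eqP.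
rewrite mulf_eq0 pnatr_eq0 /= => /eqP/balanced_laplacian_ker.
move=> /(_ (Ordinal (ltnW n2)) (Ordinal n2)); rewrite !mxE eqxx.
by move/eqP; rewrite (_ : _ == _ = false) // oner_eq0.
Qed.

(** The kernel of the symmetrized matrix consists of constant vectors, so a
    vector with zero sum is orthogonal to it. *)
Lemma symmetrized_lambda2_gap (s : 'cV[R]_n) :
  \sum_i s i 0 = 0 -> lambda2 M * dotv s s <= 2 * dotv s (N *m s).
Proof.
move=> s0; have [_ gap] := lambda2_gap symmetrized_sym symmetrized_ge0.
rewrite -dotv_symmetrized; apply: gap; apply/colP => i; rewrite [RHS]mxE.
pose r := (row i (kermx M))^T.
have Mr : M *m r = 0.
  by rewrite -symmetrized_sym -trmx_mul -row_mul mulmx_ker row0 trmx0.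
have : dotv r (N *m r) = 0.
  have := dotv_symmetrized r; rewrite Mr dotv0r => /esym/eqP.
  by rewrite mulf_eq0 pnatr_eq0 /= => /eqP.
move=> /balanced_laplacian_ker r_cst.
have -> : (kermx M *m s) i 0 = dotv r s.
  by rewrite mxE; apply: eq_bigr => j _; rewrite !mxE.
rewrite /dotv (eq_bigr (fun j => r i 0 * s j 0)) => [|j _]; last by rewrite (r_cst j i).
by rewrite -mulr_sumr s0 mulr0.
Qed.

(** Subtracting the unweighted mean [a] does not change the form, and brings
    the preceding gap into play; the [vbar]-weighted mean of [s] is [0], so the
    weighted second moment of [s] is at most that of [s - a], and [vbar <= 1]. *)
Lemma weighted_lambda2_gap (s : 'cV[R]_n) : (2 <= n)%N ->
  \sum_i vbar i 0 * s i 0 = 0 ->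
  lambda2 M * \sum_i vbar i 0 * s i 0 ^+ 2 <= 2 * dotv s (N *m s).
Proof.
move=> n2 s0.
pose a := n%:R^-1 * \sum_i s i 0; pose r : 'cV[R]_n := \col_i (s i 0 - a).
have nn : n%:R != 0 :> R by rewrite pnatr_eq0 -lt0n ltnW.
have r0 : \sum_i r i 0 = 0.
  under eq_bigr do rewrite mxE.
  by rewrite sumrB sumr_const card_ord /a -mulr_natl; field.
have -> : 2 * dotv s (N *m s) = 2 * dotv r (N *m r).
  rewrite !dotv_balanced_laplacian; apply: eq_bigr => i _; apply: eq_bigr => j _.
  by rewrite !mxE; ring.
apply: le_trans (symmetrized_lambda2_gap r0).
apply: ler_wpM2l; first exact/ltW/symmetrized_lambda2_gt0.
have vE : \sum_i vbar i 0 * (s i 0 - a) ^+ 2 = \sum_i vbar i 0 * s i 0 ^+ 2 + a ^+ 2.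
  rewrite (eq_bigr (fun i => vbar i 0 * s i 0 ^+ 2 - 2 * a * (vbar i 0 * s i 0)
                        + vbar i 0 * a ^+ 2)) => [|i _]; last by ring.
  by rewrite big_split sumrB /= -mulr_sumr s0 -mulr_suml vbar_sum; ring.
apply: (@le_trans _ _ (\sum_i vbar i 0 * (s i 0 - a) ^+ 2)).
  by rewrite vE lerDl sqr_ge0.
apply: ler_sum => i _; rewrite !mxE -expr2 ler_piMl ?sqr_ge0 //.
rewrite -vbar_sum (bigD1 i) //= lerDl; apply: sumr_ge0 => j _; exact: ltW.
Qed.

End LaplacianForm.

(** * Kronecker products with the identity *)

Section Kronecker.
Variables (R : realType) (n m : nat).
Implicit Types (x y : 'cV[R]_(n * m)) (M : 'M[R]_n) (w : 'cV[R]_n) (z : 'cV[R]_m).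

(** Component [l] of all the blocks: [M *t 1%:M] acts on each slice as [M]. *)
Definition slice x (l : 'I_m) : 'cV[R]_n := \col_i x (mxtens_index (i, l)) 0.

(** The square matrix [Umx *m Umx^T]; it spares the [1 * m] columns of [Umx]. *)
Definition block_sum : 'M[R]_(n * m) := (const_mx 1 : 'M[R]_n) *t 1%:M.
Let J := block_sum.

Lemma sum_mxtens (F : 'I_(n * m) -> R) :
  \sum_p F p = \sum_l \sum_i F (mxtens_index (i, l)).
Proof.
rewrite exchange_big /= pair_big /=.
rewrite (reindex (@mxtens_index n m)) /=; last first.
  by exists (@mxtens_unindex n m) => i _; rewrite ?mxtens_indexK ?mxtens_unindexK.
by apply: eq_bigr => -[i l] _.
Qed.

Lemma dotv_slice x y : dotv x y = \sum_l dotv (slice x l) (slice y l).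
Proof.
rewrite /dotv sum_mxtens; apply: eq_bigr => l _; apply: eq_bigr => i _.
by rewrite !mxE.
Qed.

Lemma slice_inj x y : (forall l, slice x l = slice y l) -> x = y.
Proof.
move=> xy; apply/colP => p; case: (mxtens_indexP p) => i l.
by move/colP/(_ i): (xy l); rewrite !mxE.
Qed.

Lemma slice_tens M x l : slice ((M *t 1%:M) *m x) l = M *m slice x l.
Proof.
apply/colP => i; rewrite !mxE sum_mxtens (bigD1 l) //= [X in _ + X]big1 ?addr0.
  by apply: eq_bigr => j _; rewrite tensmxE !mxE eqxx mulr1.
move=> k kl; apply: big1 => j _.
by rewrite tensmxE !mxE eq_sym (negbTE kl) mulr0 mul0r.
Qed.

Lemma tenscE w z i l : tensc w z (mxtens_index (i, l)) 0 = w i 0 * z l 0.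
Proof.
rewrite mxE mxtens_indexK /=.
by congr (w _ _ * z _ _); apply: val_inj; rewrite /= ?modn1 ?divn1.
Qed.

Lemma slice_tensc w z l : slice (tensc w z) l = z l 0 *: w.
Proof. by apply/colP => i; rewrite mxE tenscE mxE mulrC. Qed.

Lemma tensc0 z : tensc (0 : 'cV[R]_n) z = 0.
Proof.
apply: slice_inj => l; rewrite slice_tensc scaler0.
by apply/colP => i; rewrite !mxE.
Qed.

Lemma tenscD w z (z' : 'cV[R]_m) : tensc w (z + z') = tensc w z + tensc w z'.
Proof.
apply/colP => p; case: (mxtens_indexP p) => i l.
by rewrite tenscE [RHS]mxE !tenscE mxE mulrDr.
Qed.

Lemma tensc_onesE z (i : 'I_n) l : tensc ones z (mxtens_index (i, l)) 0 = z l 0.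
Proof. by rewrite tenscE mxE mul1r. Qed.

Lemma tens_mul_tensc M w z : (M *t 1%:M) *m tensc w z = tensc (M *m w) z.
Proof. by apply: slice_inj => l; rewrite slice_tens !slice_tensc scalemxAr. Qed.

Lemma tens1_mul M (M' : 'M[R]_n) :
  (M *t 1%:M) *m (M' *t 1%:M) = (M *m M') *t 1%:M :> 'M[R]_(n * m).
Proof. by rewrite tensmx_mul mulmx1. Qed.

Lemma tens1_tr M : (M *t 1%:M)^T = M^T *t 1%:M :> 'M[R]_(n * m).
Proof. by rewrite trmx_tens trmx1. Qed.

Lemma tens1_0 : 0 *t 1%:M = 0 :> 'M[R]_(n * m).
Proof. exact: tens0mx. Qed.

Lemma diagc_tensc w : diagc (tensc w ones) = diagc w *t 1%:M :> 'M[R]_(n * m).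
Proof.
apply/matrixP => p q; case: (mxtens_indexP p) => i k; case: (mxtens_indexP q) => j l.
rewrite tensmxE [LHS]mxE (can_eq (@mxtens_indexK n m)) xpair_eqE.
have -> : (tensc w ones)^T 0 (mxtens_index (i, k)) = w i 0.
  by rewrite mxE tenscE [ones _ _]mxE mulr1.
rewrite !mxE; case: (i == j); case: (k == l); rewrite ?mulr1 ?mulr0 ?mul0r //.
Qed.

Lemma block_sum_tr : J^T = J.
Proof. by rewrite tens1_tr trmx_const. Qed.

Lemma const_mx1_mul (k l : nat) :
  (const_mx 1 : 'M[R]_(k, n)) *m (const_mx 1 : 'M[R]_(n, l)) = n%:R *: const_mx 1.
Proof.
apply/matrixP => i j; rewrite !mxE; under eq_bigr do rewrite !mxE mulr1.
by rewrite sumr_const card_ord mulr1.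
Qed.

Lemma block_sum_mul : J *m J = n%:R *: J.
Proof.
by rewrite tens1_mul const_mx1_mul; apply/matrixP => i j; rewrite !mxE mulrA.
Qed.

Lemma Umx_mul_tr : (Umx : 'M[R]_(n * m, 1 * m)) *m Umx^T = J.
Proof.
rewrite /Umx trmx_tens tensmx_mul trmx1 mulmx1 trmx_const; congr (_ *t _).
by apply/matrixP => i j; rewrite !mxE big_ord1 !mxE mulr1.
Qed.

Lemma slice_block_sum x l : slice (J *m x) l = const_mx (\sum_i x (mxtens_index (i, l)) 0).
Proof.
rewrite slice_tens; apply/colP => i; rewrite !mxE.
by apply: eq_bigr => j _; rewrite !mxE mul1r.
Qed.

Lemma block_sum_eq0 x : (0 < n)%N -> J *m x = 0 -> forall l, \sum_i slice x l i 0 = 0.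
Proof.
move=> n0 Jx l; have := slice_block_sum x l; rewrite Jx.
move=> /colP/(_ (Ordinal n0)); rewrite !mxE.
by move=> sum0; rewrite [RHS]sum0; apply: eq_bigr => i _; rewrite mxE.
Qed.

Lemma block_sum_tensc_ones z : J *m tensc ones z = n%:R *: tensc ones z.
Proof.
rewrite tens_mul_tensc const_mx1_mul; apply: slice_inj => l.
by apply/colP => i; rewrite !mxE mulrA.
Qed.

Lemma block_sum_stack (c : 'I_n -> 'cV[R]_m) :
  J *m stack c = tensc ones (\sum_i c i).
Proof.
apply: slice_inj => l; rewrite slice_block_sum slice_tensc; apply/colP => i.
rewrite !mxE mulr1 summxE; apply: eq_bigr => j _.
by rewrite mxE mxtens_indexK.
Qed.

Lemma blkdiag_tensc_ones (A : 'I_n -> 'M[R]_m) z :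
  blkdiag A *m tensc ones z = stack (fun i => A i *m z).
Proof.
apply/colP => p; case: (mxtens_indexP p) => i k; rewrite !mxE sum_mxtens mxtens_indexK /=.
apply: eq_bigr => l _; rewrite (bigD1 i) //= big1 ?addr0 => [|j ji]; last first.
  by rewrite !mxE !mxtens_indexK /= eq_sym (negbTE ji) mul0r.
rewrite !mxE !mxtens_indexK /= eqxx mul1r.
by congr (_ * z _ _); apply: val_inj; rewrite /= ?modn1.
Qed.

Lemma constant_slices x : (0 < n)%N ->
  (forall l i j, slice x l i 0 = slice x l j 0) -> exists z, x = tensc ones z.
Proof.
move=> n0 x_cst; exists (\col_l slice x l (Ordinal n0) 0); apply: slice_inj => l.
by apply/colP => i; rewrite (x_cst l i (Ordinal n0)) [RHS]mxE tensc_onesE mxE.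
Qed.

End Kronecker.

(** * The quadratic forms of the Lyapunov function *)

Section QuadraticForms.
Variables (R : realType) (n m : nat) (G : wdigraph R n) (vbar : 'cV[R]_n).
Hypothesis n_ge2 : (2 <= n)%N.
Hypothesis Gsc : strongly_connected G.
Hypothesis vbar_ker : laplacian G *m vbar = 0.
Hypothesis vbar_gt0 : forall i, 0 < vbar i 0.
Hypothesis vbar_sum : \sum_(i < n) vbar i 0 = 1.

Let n_gt0 : (0 < n)%N := ltnW n_ge2.
Let L := laplacian G.
Let N := balanced_laplacian G vbar.
Let lam := lambda2 (L *m diagc vbar + diagc vbar *m L^T).
Let bL : 'M[R]_(n * m) := L *t 1%:M.
Let bV : 'M[R]_(n * m) := diagc (tensc vbar ones).
Let J : 'M[R]_(n * m) := block_sum R n m.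

Definition stacked_laplacian : 'M[R]_(n * m) := N *t 1%:M.
Let bN := stacked_laplacian.

Lemma laplacian_form_symmetrized : L *m diagc vbar + diagc vbar *m L^T = N + N^T.
Proof. by rewrite /N /balanced_laplacian trmx_mul /diagc tr_diag_mx. Qed.

Lemma laplacian_form_lambda2_gt0 : 0 < lam.
Proof. by rewrite /lam laplacian_form_symmetrized; exact: symmetrized_lambda2_gt0. Qed.

Lemma stacked_laplacianE : bL *m bV = bN.
Proof. by rewrite /bV diagc_tensc tens1_mul. Qed.

Lemma dotv_stacked_laplacian x : dotv x (bN *m x) = \sum_l dotv (slice x l) (N *m slice x l).
Proof. by rewrite dotv_slice; apply: eq_bigr => l _; rewrite slice_tens. Qed.

Lemma stacked_laplacian_gap y :
  J *m y = 0 -> lam * dotv y y <= 2 * dotv y (bN *m y).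
Proof.
move=> Jy; rewrite dotv_stacked_laplacian dotv_slice !mulr_sumr; apply: ler_sum => l _.
rewrite /lam laplacian_form_symmetrized; apply: symmetrized_lambda2_gap => //.
exact: block_sum_eq0.
Qed.

(** The form of the gap that the weight error satisfies, with [bV *m f] the
    error itself. *)
Lemma stacked_laplacian_weighted_gap f :
  J *m (bV *m f) = 0 -> lam * dotv f (bV *m f) <= 2 * dotv f (bN *m f).
Proof.
move=> Jf; rewrite dotv_stacked_laplacian dotv_slice !mulr_sumr; apply: ler_sum => l _.
have bVf i : slice (bV *m f) l i 0 = vbar i 0 * slice f l i 0.
  by rewrite /bV diagc_tensc slice_tens /diagc mul_diag_mx !mxE.
have -> : dotv (slice f l) (slice (bV *m f) l) = \sum_i vbar i 0 * slice f l i 0 ^+ 2.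
  by apply: eq_bigr => i _; rewrite bVf; ring.
rewrite /lam laplacian_form_symmetrized; apply: weighted_lambda2_gap => //.
by have := block_sum_eq0 n_gt0 Jf l; under eq_bigr do rewrite bVf.
Qed.

Lemma stacked_laplacian_ge0 x : 0 <= dotv x (bN *m x).
Proof.
by rewrite dotv_stacked_laplacian; apply: sumr_ge0 => l _; exact: balanced_laplacian_ge0.
Qed.

Lemma stacked_laplacian_ker x :
  dotv x (bN *m x) = 0 -> exists z, x = tensc ones z.
Proof.
rewrite dotv_stacked_laplacian => /eqP.
rewrite psumr_eq0 => [/allP xN0|l _]; last exact: balanced_laplacian_ge0.
apply: constant_slices => // l.
by apply: (balanced_laplacian_ker Gsc vbar_ker vbar_gt0); apply/eqP/xN0/mem_index_enum.
Qed.

Lemma balanced_laplacian_const k : N *m (const_mx 1 : 'M[R]_(n, k)) = 0.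
Proof.
have scaled_ones : diagc vbar *m (const_mx 1 : 'M[R]_(n, k)) = vbar *m const_mx 1.
  by apply/matrixP => i j; rewrite /diagc mul_diag_mx !mxE big_ord1 !mxE.
by rewrite /N /balanced_laplacian -mulmxA scaled_ones mulmxA vbar_ker mul0mx.
Qed.

Lemma stacked_laplacian_tensc_ones z : bN *m tensc ones z = 0.
Proof.
by rewrite tens_mul_tensc balanced_laplacian_const tensc0.
Qed.

Lemma stacked_laplacian_block_sum : bN *m J = 0.
Proof. by rewrite tens1_mul balanced_laplacian_const tens1_0. Qed.

Lemma block_sum_mul_laplacian : J *m bL = 0.
Proof. by rewrite tens1_mul ones_mul_laplacian tens1_0. Qed.

Variables (A : 'I_n -> 'M[R]_m) (alpha beta gamma : R).
Hypothesis nullA : forall i : 'I_n, null (\sum_(j < n) A j) `<=` null (A i).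
Hypothesis alpha_gt0 : 0 < alpha.
Hypothesis beta_gt0 : 0 < beta.
Let bA := blkdiag A.
Let q11 := Q11 L A vbar alpha beta.
Let q12 := Q12 L A vbar alpha beta.

Lemma Q11E : q11 = (2^-1 * alpha) *: (bN + bN^T) + beta *: (bA^T *m J *m bA).
Proof.
rewrite /q11 /Q11 -/bL -/bV -/bA stacked_laplacianE.
rewrite -(mulmxA bA^T Umx) Umx_mul_tr; congr (_ *: (_ + _) + _).
by rewrite -stacked_laplacianE trmx_mul /bV /diagc tr_diag_mx.
Qed.

Lemma Q11_sym : q11^T = q11.
Proof.
rewrite Q11E linearD !linearZ /= linearD /= trmxK (addrC bN^T).
by rewrite !trmx_mul trmxK block_sum_tr mulmxA.
Qed.

Lemma dotv_Q11 x : dotv x (q11 *m x) =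
  alpha * dotv x (bN *m x) + beta * dotv (Umx^T *m (bA *m x)) (Umx^T *m (bA *m x)).
Proof.
rewrite Q11E mulmxDl -!scalemxAl mulmxDl dotvDr !dotvZr dotvDr.
rewrite (dotv_mulmxr bN^T) trmxK (dotvC (bN *m x)); congr (_ + _).
  by field.
rewrite /J -Umx_mul_tr -!mulmxA (dotv_mulmxr bA^T) trmxK.
by rewrite (dotv_mulmxr Umx).
Qed.

Lemma Q11_ge0 x : 0 <= dotv x (q11 *m x).
Proof.
by rewrite dotv_Q11; apply: addr_ge0; apply: mulr_ge0;
  [exact: ltW|exact: stacked_laplacian_ge0|exact: ltW|exact: dotvv_ge0].
Qed.

(** Both terms of the form vanish: the first forces [x] to be a stack of copies
    of some [z], the second then says that the sum of the [A i] kills [z], and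
    so does every [A i] by the inclusion of null spaces. *)
Lemma Q11_ker x : q11 *m x = 0 ->
  exists z, [/\ x = tensc ones z, (\sum_i A i) *m z = 0 & bA *m x = 0].
Proof.
move=> Qx; have := dotv_Q11 x; rewrite Qx dotv0r => /esym/eqP.
have N0 : 0 <= alpha * dotv x (bN *m x).
  by apply: mulr_ge0; [exact: ltW|exact: stacked_laplacian_ge0].
have U0 : 0 <= beta * dotv (Umx^T *m (bA *m x)) (Umx^T *m (bA *m x)).
  by apply: mulr_ge0; [exact: ltW|exact: dotvv_ge0].
rewrite paddr_eq0 // !mulf_eq0 (gt_eqF alpha_gt0) (gt_eqF beta_gt0) /=.
move=> /andP[/eqP/stacked_laplacian_ker[z xz] /eqP/dotvv_eq0 UAx]; exists z.
have sumAz : (\sum_i A i) *m z = 0.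
  have : J *m (bA *m x) = 0 by rewrite /J -Umx_mul_tr -mulmxA UAx mulmx0.
  rewrite xz blkdiag_tensc_ones block_sum_stack -mulmx_suml => Az0.
  apply/colP => l; rewrite -(tensc_onesE ((\sum_i A i) *m z) (Ordinal n_gt0)).
  by rewrite Az0 !mxE.
split=> //; rewrite xz blkdiag_tensc_ones.
by apply/colP => p; rewrite [LHS]mxE (nullA (mxtens_unindex p).1 sumAz) !mxE.
Qed.

Lemma Q11_lambda2_gt0 : (0 < m)%N -> 0 < lambda2 q11.
Proof.
move=> m_gt0; have [+ _] := lambda2_gap Q11_sym Q11_ge0; apply; apply/eqP => Q0.
pose i0 := Ordinal n_gt0; pose i1 := Ordinal n_ge2; pose l := Ordinal m_gt0.
pose e : 'cV[R]_(n * m) := \col_p (p == mxtens_index (i0, l))%:R.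
have [|z [ez _ _]] := Q11_ker (x := e); first by rewrite Q0 mul0mx.
have eE i : slice e l i 0 = z l 0.
  by rewrite mxE ez tensc_onesE.
have := etrans (eE i0) (esym (eE i1)); rewrite !mxE !(can_eq (@mxtens_indexK n m)).
by rewrite !xpair_eqE !eqxx /= => /eqP; rewrite oner_eq0.
Qed.

Lemma dotv_Q12 x y : 2 * dotv x (q12 *m y) =
  n%:R * beta * dotv x (bA^T *m y) + alpha * dotv y (bA *m (bN *m x))
  + beta * dotv y (bA *m (bA^T *m (J *m (bA *m x)))).
Proof.
rewrite /q12 /Q12 -/bL -/bV -/bA -(mulmxA bA^T Umx) Umx_mul_tr -/J.
have -> : bV *m bL^T = bN^T.
  by rewrite -stacked_laplacianE trmx_mul /bV /diagc tr_diag_mx.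
rewrite -scalemxAl dotvZr mulrA divff // mul1r !mulmxDl !dotvDr.
rewrite -!scalemxAl !dotvZr; congr (_ * _ + _ * _ + _ * _).
  by rewrite dotv_mulmxr trmx_mul !trmxK -mulmxA dotvC.
by rewrite dotv_mulmxr !trmx_mul !trmxK block_sum_tr -!mulmxA dotvC.
Qed.

Hypothesis gamma_gt : gamma_bar L A vbar alpha beta < gamma.

(** With [l11 = lambda2 Q11] and [r = x + Q12 y / l11], the form is at least
    [l11 |r|^2 + delta |y|^2]: the completed square costs [|Q12 y|^2 / l11], which
    [lambda_max] compares with [n beta |bA^T y|^2], and [gamma] times the gap of
    the Laplacian form covers the difference with the margin [delta]. *)
Lemma dissipation_coercive : (0 < m)%N ->
  exists2 c : R, 0 < c & forall x y, kermx q11 *m x = 0 -> J *m y = 0 ->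
    c * (dotv x x + dotv y y) <=
      dotv x (q11 *m x) + 2 * dotv x (q12 *m y)
      + n%:R * beta * dotv (bA^T *m y) (bA^T *m y) + gamma * dotv y (bN *m y).
Proof.
move=> m_gt0; have lam_gt0 := laplacian_form_lambda2_gt0.
have l11_gt0 := Q11_lambda2_gt0 m_gt0; set l11 := lambda2 q11 in l11_gt0.
pose S := l11^-1 *: (q12^T *m q12) - (n%:R * beta) *: (bA *m bA^T).
pose mx := lambda_max S.
have [gamma_mx gamma_gt0] : 2 / lam * mx < gamma /\ 0 < gamma.
  by apply/andP; rewrite -gt_max; exact: gamma_gt.
have S_sym : S^T = S.
  exact: gram_difference_sym.
pose delta := gamma * lam / 2 - mx.
have delta_gt0 : 0 < delta.
  move: gamma_mx; rewrite mulrAC ltr_pdivrMr // /delta; lra.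
have [B B_ge0 q12_le] := mulmx_dotv_bound q12.
pose D := 1 + 2 * B / l11 ^+ 2.
have D_gt0 : 0 < D by rewrite /D ltr_pwDl // divr_ge0 ?mulr_ge0 ?exprn_ge0 // ltW.
(* From [x = r - Q12 y / l11]: [|x|^2 + |y|^2 <= 2 |r|^2 + D |y|^2]. *)
pose c := Num.min (l11 / 2) (delta / D).
have c_gt0 : 0 < c by rewrite /c lt_min !divr_gt0.
exists c => // x y Kx Jy.
have [_ /(_ x Kx) Q11_gap] := lambda2_gap Q11_sym Q11_ge0.
have := stacked_laplacian_gap Jy.
move=> /(ler_wpM2l (ltW gamma_gt0)) N_gap.
have S_le := rayleigh_le_lambda_max S_sym y.
rewrite -/mx mulmxBl dotvBr -!scalemxAl !dotvZr dotv_gram dotv_cogram in S_le.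
pose r := x + l11^-1 *: (q12 *m y).
have rr : l11 * dotv r r = l11 * dotv x x + 2 * dotv x (q12 *m y)
    + l11^-1 * dotv (q12 *m y) (q12 *m y).
  rewrite /r !(dotvDl, dotvDr, dotvZl, dotvZr) (dotvC (q12 *m y) x).
  by field; rewrite gt_eqF.
have xx : dotv x x <= 2 * dotv r r + 2 * B / l11 ^+ 2 * dotv y y.
  have -> : x = r - l11^-1 *: (q12 *m y) by rewrite /r addrK.
  apply: le_trans (dotv_sqrD_le _ _) _.
  rewrite dotvNl dotvNr opprK dotvZl dotvZr mulrDr lerD2l.
  have -> : 2 * (l11^-1 * (l11^-1 * dotv (q12 *m y) (q12 *m y))) =
      2 / l11 ^+ 2 * dotv (q12 *m y) (q12 *m y) by field; rewrite gt_eqF.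
  have -> : 2 * B / l11 ^+ 2 * dotv y y = 2 / l11 ^+ 2 * (B * dotv y y).
    by field; rewrite gt_eqF.
  by apply: ler_wpM2l => //; rewrite divr_ge0 // exprn_ge0 // ltW.
have cr : c * (2 * dotv r r) <= l11 * dotv r r.
  have : c <= l11 / 2 by rewrite /c ge_min lexx.
  move=> /(ler_wpM2r (dotvv_ge0 r)); lra.
have cy : c * (D * dotv y y) <= delta * dotv y y.
  have : c <= delta / D by rewrite /c ge_min lexx orbT.
  rewrite ler_pdivlMr // => /(ler_wpM2r (dotvv_ge0 y)); lra.
have xy : c * (dotv x x + dotv y y) <= c * (2 * dotv r r + D * dotv y y).
  by apply: ler_wpM2l; [exact: ltW|rewrite /D; lra].
rewrite -/l11 in Q11_gap.
have dyy : delta * dotv y y = gamma * (lam * dotv y y) / 2 - mx * dotv y y.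
  by rewrite /delta; ring.
move: Q11_gap N_gap S_le rr cr cy xy dyy.
move: (dotv x (q11 *m x)) (dotv x (q12 *m y)) (dotv (bA^T *m y) _) (dotv y (bN *m y)) => *.
lra.
Qed.

End QuadraticForms.

(** * Convergence of the weights *)

Section Dynamics.
Variables (R : realType) (n m : nat) (G : wdigraph R n) (vbar : 'cV[R]_n).
Hypothesis n_ge2 : (2 <= n)%N.
Hypothesis Gsc : strongly_connected G.
Hypothesis vbar_ker : laplacian G *m vbar = 0.
Hypothesis vbar_gt0 : forall i, 0 < vbar i 0.
Hypothesis vbar_sum : \sum_(i < n) vbar i 0 = 1.

Let n_gt0 : (0 < n)%N := ltnW n_ge2.
Let L := laplacian G.
Let bL : 'M[R]_(n * m) := L *t 1%:M.
Let vb : 'cV[R]_(n * m) := tensc vbar ones.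
Let bV : 'M[R]_(n * m) := diagc vb.
Let J : 'M[R]_(n * m) := block_sum R n m.
Let bN : 'M[R]_(n * m) := stacked_laplacian m G vbar.

(** The Lyapunov function is [e^T f] with [e = bV *m f]; its derivative is
    [- 2 f^T bL bV f], and [e] keeps zero block sums. *)
Lemma weights_converge (v : R -> 'cV[R]_(n * m)) :
  vec_deriv v (fun t => - (bL *m v t)) -> v 0 = n%:R^-1 *: ones ->
  exists C rho : R, [/\ 0 <= C, 0 < rho &
    forall t, 0 <= t -> dotv (v t - vb) (v t - vb) <= C * expR (- rho * t)].
Proof.
move=> vP v0.
have nn : n%:R != 0 :> R by rewrite pnatr_eq0 -lt0n.
pose e t := v t - vb; pose vinv : 'cV[R]_(n * m) := \col_p (vb p 0)^-1.
have vinvE p : vinv p 0 = (vb p 0)^-1 by rewrite mxE.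
have vb_gt0 p : 0 < vb p 0.
  by case: (mxtens_indexP p) => i l; rewrite tenscE [ones _ _]mxE mulr1.
have vb_le1 p : vb p 0 <= 1.
  case: (mxtens_indexP p) => i l; rewrite tenscE [ones _ _]mxE mulr1.
  by rewrite -vbar_sum (bigD1 i) //= lerDl; apply: sumr_ge0 => j _; exact: ltW.
have bLvb : bL *m vb = 0.
  by rewrite tens_mul_tensc vbar_ker tensc0.
have eP : vec_deriv e (fun t => - (bL *m e t)).
  have := vec_derivD vP (vec_deriv_cst (- vb)); congr vec_deriv; apply/funext => t.
  by rewrite addr0 /e mulmxBr bLvb subr0.
have Je t : 0 <= t -> J *m e t = 0.
  move=> t_ge0; have := vec_deriv0_cst (vec_deriv_mulmx J eP) _ t_ge0.
  move=> -> => [|s _]; last by rewrite mulmxN mulmxA block_sum_mul_laplacian mul0mx oppr0.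
  rewrite /e v0 mulmxBr -scalemxAr; apply/eqP; rewrite subr_eq0; apply/eqP.
  have -> : ones = tensc ones ones :> 'cV[R]_(n * m).
    by apply/colP => p; rewrite !mxE mulr1.
  rewrite block_sum_tensc_ones scalerA mulVf // scale1r tens_mul_tensc.
  congr tensc; apply/colP => i; rewrite [LHS]mxE -[LHS]vbar_sum mxE.
  by apply: eq_bigr => j _; rewrite mxE mul1r.
pose f t := diagc vinv *m e t.
have fE t : bV *m f t = e t.
  by apply/colP => p; rewrite !diagcE vinvE mulrA divff ?mul1r // gt_eqF.
pose S t := dotv (e t) (f t).
have SE t : S t = \sum_p (vb p 0)^-1 * e t p 0 ^+ 2.
  by apply: eq_bigr => p _; rewrite diagcE vinvE; ring.
have S_ge0 t : 0 <= S t.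
  rewrite SE; apply: sumr_ge0 => p _; by rewrite mulr_ge0 ?sqr_ge0 // invr_ge0 ltW.
have SP : halfline_deriv S _ := vec_deriv_dotv eP (vec_deriv_mulmx (diagc vinv) eP).
set lam := lambda2 (L *m diagc vbar + diagc vbar *m L^T).
have lam_gt0 : 0 < lam by exact: laplacian_form_lambda2_gt0.
have [|||t t_gt0|C [rho [C_ge0 rho_gt0 S_le]]] := @perturbed_gronwall R S _ lam 1 0 SP S_ge0.
- by [].
- exact: ltr01.
- exact: lexx.
- rewrite mul0r mul0r addr0.
  have Vsym : (diagc vinv)^T = diagc vinv by rewrite /diagc tr_diag_mx.
  rewrite (dotv_mulmxr _ (e t) (- _)) Vsym -/(f t) dotvNl dotvNr (dotvC (bL *m _)).
  rewrite -{1 2}(fE t) mulmxA stacked_laplacianE.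
  have := @stacked_laplacian_weighted_gap R n m G vbar n_ge2 Gsc vbar_ker vbar_gt0 vbar_sum (f t).
  rewrite fE -/lam -/bN => /(_ (Je t (ltW t_gt0))); rewrite /S (dotvC (e t)); lra.
exists C, rho; split=> // t t_ge0; apply: le_trans (S_le t t_ge0).
rewrite SE /dotv; apply: ler_sum => p _; rewrite -expr2 -/(e t).
by rewrite -[leLHS]mul1r ler_wpM2r ?sqr_ge0 // invf_ge1.
Qed.

End Dynamics.

(** * Energy balance *)

Section Energy.
Variables (R : realType) (n m : nat) (G : wdigraph R n) (vbar : 'cV[R]_n).
Hypothesis n_ge2 : (2 <= n)%N.
Hypothesis Gsc : strongly_connected G.
Hypothesis vbar_ker : laplacian G *m vbar = 0.
Hypothesis vbar_gt0 : forall i, 0 < vbar i 0.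
Hypothesis vbar_sum : \sum_(i < n) vbar i 0 = 1.
Variables (A : 'I_n -> 'M[R]_m) (alpha beta gamma : R).
Hypothesis nullA : forall i : 'I_n, null (\sum_(j < n) A j) `<=` null (A i).
Hypothesis alpha_gt0 : 0 < alpha.
Hypothesis beta_gt0 : 0 < beta.

Let n_gt0 : (0 < n)%N := ltnW n_ge2.
Let n_neq0 : n%:R != 0 :> R.
Proof. by rewrite pnatr_eq0 -lt0n. Qed.
Let L := laplacian G.
Let bL : 'M[R]_(n * m) := L *t 1%:M.
Let vb : 'cV[R]_(n * m) := tensc vbar ones.
Let J : 'M[R]_(n * m) := block_sum R n m.
Let bN : 'M[R]_(n * m) := stacked_laplacian m G vbar.
Let bA := blkdiag A.
Let q11 := Q11 L A vbar alpha beta.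
Let q12 := Q12 L A vbar alpha beta.
Let K := kermx q11.

(** A row of [K] is the transpose of a stack of copies of one vector, hence
    orthogonal to the range of [bL], and [bA] kills that stack.  These are the
    two matrices through which the derivative of [x] passes, so [K *m x] is
    constant along trajectories. *)
Lemma kermx_Q11_invariant : K *m bL = 0 /\ K *m bA^T = 0.
Proof.
have q11_sym := Q11_sym G vbar A alpha beta.
have row_ker i : exists z, [/\ (row i K)^T = tensc ones z,
    (\sum_i A i) *m z = 0 & bA *m (row i K)^T = 0].
  apply: (Q11_ker n_ge2 Gsc vbar_ker vbar_gt0 nullA alpha_gt0 beta_gt0).
  by rewrite -q11_sym -trmx_mul -row_mul mulmx_ker row0 trmx0.
split; apply/row_matrixP => i; rewrite row_mul row0; apply: trmx_inj; rewrite trmx0.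
  have [z [rowE _ _]] := row_ker i.
  rewrite trmx_mul rowE -[tensc ones z](scalerK n_neq0) -block_sum_tensc_ones.
  rewrite -scalemxAr mulmxA -{1}(block_sum_tr R n m) -trmx_mul.
  by rewrite block_sum_mul_laplacian trmx0 mul0mx scaler0.
by have [z [_ _]] := row_ker i; rewrite trmx_mul trmxK.
Qed.

(** The orthogonal projection of [x] on the kernel of [Q11]. *)
Lemma ker_Q11_component (x : 'cV[R]_(n * m)) :
  exists z, (\sum_i A i) *m z = 0 /\ K *m tensc ones z = K *m x.
Proof.
have [c cE] := orthogonal_projection_on_rows K x.
have [|z [cz Az _]] := Q11_ker n_ge2 Gsc vbar_ker vbar_gt0 nullA alpha_gt0 beta_gt0
    (x := K^T *m c).
  by rewrite mulmxA -(Q11_sym G vbar A alpha beta) -trmx_mul mulmx_ker trmx0 mul0mx.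
by exists z; rewrite -cz.
Qed.

(** Half the derivative of [|xt|^2 + |p|^2].  Writing the weights as [vb + e] and
    [y] as [p] plus the mean [n^-1 J bA xt] of its blocks turns the linear terms
    into the blocks [Q11] and [Q12]; what remains is linear in [e]. *)
Lemma energy_balance (x y e X : 'cV[R]_(n * m)) :
  let xt := x - X in let p := y - n%:R^-1 *: (J *m y) in
  bN *m X = 0 -> J *m y = J *m (bA *m xt) ->
  dotv xt (- (alpha *: (bL *m diagc (vb + e) *m x)) - (n%:R * beta) *: (bA^T *m y))
  + dotv p (- (alpha *: (bA *m bL *m diagc (vb + e) *m x))
            - (n%:R * beta) *: (bA *m bA^T *m y)
            - gamma *: (bL *m diagc (vb + e) *m y))
  = - (dotv xt (q11 *m xt) + 2 * dotv xt (q12 *m p)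
       + n%:R * beta * dotv (bA^T *m p) (bA^T *m p) + gamma * dotv p (bN *m p))
    - (alpha * dotv xt (bL *m (diagc e *m x))
       + alpha * dotv p (bA *m bL *m (diagc e *m x))
       + gamma * dotv p (bL *m (diagc e *m y))).
Proof.
move=> xt p bNX Jy.
have yE : y = p + n%:R^-1 *: (J *m (bA *m xt)) by rewrite -Jy /p subrK.
have split_diag u : bL *m (diagc (vb + e) *m u) = bN *m u + bL *m (diagc e *m u).
  by rewrite diagcD mulmxDl mulmxDr mulmxA stacked_laplacianE.
have bNx : bN *m x = bN *m xt by rewrite /xt mulmxBr bNX subr0.
have bNy : bN *m y = bN *m p.
  have NJ : bN *m J = 0 by exact: stacked_laplacian_block_sum.
  by rewrite /p mulmxBr -scalemxAr (mulmxA bN) NJ mul0mx scaler0 subr0.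
rewrite -!(mulmxA bA) -!(mulmxA bL) !split_diag bNx bNy.
set gx := bL *m (diagc e *m x); set gy := bL *m (diagc e *m y).
clearbody xt p gx gy.
rewrite dotv_Q12 dotv_Q11 -/bA.
have -> : dotv (Umx^T *m (bA *m xt)) (Umx^T *m (bA *m xt)) = dotv xt (bA^T *m (J *m (bA *m xt))).
  by rewrite /J -Umx_mul_tr -!mulmxA (dotv_mulmxr bA^T) trmxK (dotv_mulmxr Umx).
have -> : dotv (bA^T *m p) (bA^T *m p) = dotv p (bA *m (bA^T *m p)).
  by rewrite (dotv_mulmxr bA).
rewrite [in bA^T *m y]yE.
rewrite !mulmxDr -!scalemxAr.
rewrite !(dotvDr, dotvNr, dotvZr).
by field.
Qed.

End Energy.

(** * Convergence of trajectories *)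

Section Trajectory.
Variables (R : realType) (n m : nat) (G : wdigraph R n) (vbar : 'cV[R]_n).
Hypothesis n_ge2 : (2 <= n)%N.
Hypothesis Gsc : strongly_connected G.
Hypothesis vbar_ker : laplacian G *m vbar = 0.
Hypothesis vbar_gt0 : forall i, 0 < vbar i 0.
Hypothesis vbar_sum : \sum_(i < n) vbar i 0 = 1.
Variables (A : 'I_n -> 'M[R]_m) (b : 'I_n -> 'cV[R]_m) (alpha beta gamma : R).
Hypothesis nullA : forall i : 'I_n, null (\sum_(j < n) A j) `<=` null (A i).
Hypothesis solvable : exists x : 'cV[R]_m, (\sum_(i < n) A i) *m x = \sum_(i < n) b i.
Hypothesis alpha_gt0 : 0 < alpha.
Hypothesis beta_gt0 : 0 < beta.
Hypothesis gamma_gt : gamma_bar (laplacian G) A vbar alpha beta < gamma.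

Let n_gt0 : (0 < n)%N := ltnW n_ge2.
Let n_neq0 : n%:R != 0 :> R.
Proof. by rewrite pnatr_eq0 -lt0n. Qed.
Let L := laplacian G.
Let bL : 'M[R]_(n * m) := L *t 1%:M.
Let vb : 'cV[R]_(n * m) := tensc vbar ones.
Let J : 'M[R]_(n * m) := block_sum R n m.
Let bN : 'M[R]_(n * m) := stacked_laplacian m G vbar.
Let bA := blkdiag A.
Let q11 := Q11 L A vbar alpha beta.
Let K := kermx q11.

Variables x y v : R -> 'cV[R]_(n * m).
Let dx t := - (alpha *: (bL *m diagc (v t) *m x t)) - (n%:R * beta) *: (bA^T *m y t).
Let dy t := - (alpha *: (bA *m bL *m diagc (v t) *m x t))
    - (n%:R * beta) *: (bA *m bA^T *m y t) - gamma *: (bL *m diagc (v t) *m y t).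
Hypothesis xP : vec_deriv x dx.
Hypothesis yP : vec_deriv y dy.
Hypothesis vP : vec_deriv v (fun t => - (bL *m v t)).
Hypothesis y0P : Umx^T *m y 0 = Umx^T *m (bA *m x 0 - stack b).
Hypothesis v0P : v 0 = n%:R^-1 *: ones.

(** The difference [dy - bA dx] is [- gamma bL V y], and [J *m bL = 0]. *)
Lemma block_sum_invariant t : 0 <= t -> J *m y t = J *m (bA *m x t - stack b).
Proof.
have JL : J *m bL = 0 by exact: block_sum_mul_laplacian.
pose r s := J *m y s - J *m (bA *m x s).
have rP : vec_deriv r (fun s => J *m dy s - J *m (bA *m dx s)).
  have := vec_derivD (vec_deriv_mulmx J yP)
    (vec_deriv_mulmx (- 1%:M) (vec_deriv_mulmx J (vec_deriv_mulmx bA xP))).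
  by congr vec_deriv; apply/funext => s; rewrite mulNmx mul1mx.
move=> t_ge0; have r_cst : r t = r 0.
  apply: (vec_deriv0_cst rP) => // s _.
  rewrite -mulmxBr (_ : dy s - bA *m dx s = - (gamma *: (bL *m diagc (v s) *m y s))).
    by rewrite mulmxN -scalemxAr !mulmxA JL !mul0mx scaler0 oppr0.
  rewrite /dx /dy mulmxBr mulmxN -!scalemxAr !mulmxA.
  by rewrite [X in X - _ = _]addrC -addrA subrr addr0.
have r0 : r 0 = - (J *m stack b).
  have J0 : J *m y 0 = J *m (bA *m x 0 - stack b).
    by rewrite /J -Umx_mul_tr -!mulmxA y0P.
  by rewrite /r J0 mulmxBr addrAC subrr add0r.
move: r_cst; rewrite r0 /r => /eqP; rewrite subr_eq => /eqP ->.
by rewrite mulmxBr addrC.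
Qed.

(** Solutions differ by elements of the kernel of the sum of the [A i]; adding
    to any solution the kernel component of the initial error makes the remaining
    error orthogonal to the kernel of [Q11]. *)
Lemma exists_equilibrium : exists xstar, [/\ (\sum_i A i) *m xstar = \sum_i b i,
  forall t, 0 <= t -> K *m (x t - tensc ones xstar) = 0 &
  forall t, 0 <= t -> J *m y t = J *m (bA *m (x t - tensc ones xstar))].
Proof.
have [x0 Ax0] := solvable.
have [z [Az Kz]] := ker_Q11_component n_ge2 Gsc vbar_ker vbar_gt0 nullA alpha_gt0 beta_gt0
  (x 0 - tensc ones x0).
have Ax : (\sum_i A i) *m (x0 + z) = \sum_i b i by rewrite mulmxDr Az addr0.
exists (x0 + z); split=> // t t_ge0.
  have [KL KA] := kermx_Q11_invariant n_ge2 Gsc vbar_ker vbar_gt0 nullA alpha_gt0 beta_gt0.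
  have Kx : K *m x t = K *m x 0.
    apply: (vec_deriv0_cst (vec_deriv_mulmx K xP)) => // s _.
    by rewrite /dx mulmxBr mulmxN -!scalemxAr !mulmxA KL KA !mul0mx !scaler0 subr0 oppr0.
  rewrite mulmxBr Kx tenscD mulmxDr [K *m tensc ones z]Kz mulmxBr.
  by rewrite [X in _ - X]addrC subrK subrr.
rewrite block_sum_invariant // mulmxBr [in RHS]mulmxBr [in RHS]mulmxBr; congr (_ - _).
by rewrite blkdiag_tensc_ones !block_sum_stack -mulmx_suml Ax.
Qed.

Hypothesis m_gt0 : (0 < m)%N.

Lemma trajectory_converges : exists xstar, (\sum_i A i) *m xstar = \sum_i b i /\
    converges_exponentially
      (fun t => col_mx (x t) (col_mx (y t) (v t)))
      (col_mx (tensc ones xstar) (col_mx 0 vb)).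
Proof.
have [xstar [Axstar Kx Jy]] := exists_equilibrium; exists xstar; split=> //.
set X := tensc ones xstar in Kx Jy *.
have [c c_gt0 coercive] := dissipation_coercive n_ge2 Gsc vbar_ker vbar_gt0 nullA
  alpha_gt0 beta_gt0 gamma_gt m_gt0.
have [Cv [rho [Cv_ge0 rho_gt0 v_le]]] :=
  weights_converge n_ge2 Gsc vbar_ker vbar_gt0 vbar_sum vP v0P.
pose P : 'M[R]_(n * m) := 1%:M - n%:R^-1 *: J.
pose e t := v t - vb; pose xt t := x t - X; pose p t := P *m y t.
have pE t : p t = y t - n%:R^-1 *: (J *m y t).
  by rewrite /p /P mulmxBl mul1mx -scalemxAl.
have xtP : vec_deriv xt dx.
  have := vec_derivD xP (vec_deriv_cst (- X)); congr vec_deriv.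
  by apply/funext => t; rewrite addr0.
have pP : vec_deriv p (fun t => P *m dy t) by exact: vec_deriv_mulmx.
have JP : J *m P = 0.
  rewrite /P mulmxBr mulmx1 -scalemxAr block_sum_mul scalerA mulVf // scale1r.
  exact: subrr.
have P_tr : P^T = P.
  by rewrite /P linearB /= trmx1 linearZ /= block_sum_tr.
have Jp t : J *m p t = 0 by rewrite mulmxA JP mul0mx.
have pPdy t : dotv (p t) (P *m dy t) = dotv (p t) (dy t).
  have pJ : dotv (p t) (J *m dy t) = 0.
    by rewrite (dotv_mulmxr J) [J^T]block_sum_tr Jp dotvC dotv0r.
  by rewrite {1}/P mulmxBl mul1mx dotvBr -scalemxAl dotvZr pJ mulr0 subr0.
pose W t := dotv (xt t) (xt t) + dotv (p t) (p t).
have W_ge0 t : 0 <= W t by rewrite addr_ge0 ?dotvv_ge0.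
have [B1 B1_ge0 pert1] := dotv_diagc_bound bL.
have [B2 B2_ge0 pert2] := dotv_diagc_bound (bA *m bL).
have [D D_ge0 y_le'] := mulmx_dotv_bound (n%:R^-1 *: (J *m bA)).
have y_le t : 0 <= t -> dotv (y t) (y t) <= 2 * (dotv (p t) (p t) + D * dotv (xt t) (xt t)).
  move=> t_ge0; have yE : y t = p t + (n%:R^-1 *: (J *m bA)) *m xt t.
    by rewrite pE (Jy t t_ge0) -scalemxAl -mulmxA subrK.
  rewrite {1 2}yE; apply: le_trans (dotv_sqrD_le _ _) _.
  by have := y_le' (xt t); lra.
have x_le t : dotv (x t) (x t) <= 2 * (dotv (xt t) (xt t) + dotv X X).
  by have := dotv_sqrD_le (xt t) X; rewrite /xt subrK.
have gamma_gt0 : 0 < gamma by apply: le_lt_trans gamma_gt; rewrite le_max lexx orbT.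
(* [Cv + 1] exceeds the square root of [Cv] and keeps [eps] positive if [Cv = 0]. *)
pose eps t := (Cv + 1) * expR (- (rho / 2) * t).
have eps_gt0 t : 0 < eps t by rewrite mulr_gt0 ?expR_gt0 //; lra.
have e_le t : 0 <= t -> forall q, `|e t q 0| <= eps t.
  move=> t_ge0 q; rewrite -(@ler_pXn2r _ 2) ?nnegrE ?(ltW (eps_gt0 _)) //.
  rewrite real_normK ?num_real //; apply: le_trans (coord_sqr_le _ _) _.
  apply: le_trans (v_le t t_ge0) _; rewrite /eps exprMn -expRM_natl.
  rewrite (_ : 2 * (- (rho / 2) * t) = - rho * t); last by field.
  by apply: ler_wpM2r; [exact: expR_ge0|nra].
pose H := alpha * B1 + alpha * B2 + gamma * B1.
have H_ge0 : 0 <= H by rewrite !addr_ge0 // mulr_ge0 // ltW.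
pose k := 2 * H * (Cv + 1) * (3 + 2 * D + 2 * dotv X X).
have XX_ge0 := dotvv_ge0 X.
have k_ge0 : 0 <= k by rewrite !mulr_ge0 // ; lra.
have WP := halfline_derivD (vec_deriv_dotv xtP xtP) (vec_deriv_dotv pP pP).
have [|||t t_gt0|C [mu [C_ge0 mu_gt0 W_le]]] :=
  @perturbed_gronwall R W _ (2 * c) (rho / 2) k WP W_ge0.
- lra.
- lra.
- by [].
- have t_ge0 := ltW t_gt0.
  rewrite (dotvC (dx t)) (dotvC (P *m dy t)) pPdy.
  have bNX : bN *m X = 0 by exact: stacked_laplacian_tensc_ones.
  have := energy_balance n_ge2 vbar_ker alpha beta gamma (e t) bNX (Jy t t_ge0).
  rewrite (_ : tensc vbar ones + e t = v t); last by rewrite addrC subrK.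
  rewrite -/(dx t) -/(dy t) -/(xt t) -pE.
  have := coercive (xt t) (p t) (Kx t t_ge0) (Jp t); rewrite -/(W t).
  set F := (X in _ <= X -> _) => W_le balance.
  set T := dotv (xt t) (xt t) + dotv (p t) (p t) + dotv (x t) (x t) + dotv (y t) (y t).
  have T_le : T <= (3 + 2 * D + 2 * dotv X X) * (W t + 1).
    have := y_le t t_ge0; have := x_le t; rewrite /T /W.
    have xx := dotvv_ge0 (xt t); have pp := dotvv_ge0 (p t).
    have := mulr_ge0 D_ge0 pp; have := mulr_ge0 XX_ge0 pp; have := mulr_ge0 XX_ge0 xx.
    move: (dotv X X) (dotv (xt t) _) (dotv (p t) _) xx pp XX_ge0 => *; lra.
  have [xx pp] := (dotvv_ge0 (xt t), dotvv_ge0 (p t)).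
  have [xx' yy] := (dotvv_ge0 (x t), dotvv_ge0 (y t)).
  have bound_T B u w d : 0 <= B -> `|d| <= B * eps t * (u + w) -> u + w <= T ->
      - d <= B * eps t * T.
    move=> B_ge0; rewrite ler_norml => /andP[d_ge _] uw.
    rewrite lerNl; apply: le_trans d_ge; rewrite lerN2; apply: ler_wpM2l => //.
    by rewrite mulr_ge0 // ltW.
  have h1 := bound_T _ _ _ _ B1_ge0
    (pert1 (xt t) (e t) (x t) (eps t) (eps_gt0 t) (e_le t t_ge0)) _.
  have {}h1 := h1 ltac:(by rewrite /T; lra).
  have h2 := bound_T _ _ _ _ B2_ge0
    (pert2 (p t) (e t) (x t) (eps t) (eps_gt0 t) (e_le t t_ge0)) _.
  have {}h2 := h2 ltac:(by rewrite /T; lra).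
  have h3 := bound_T _ _ _ _ B1_ge0
    (pert1 (p t) (e t) (y t) (eps t) (eps_gt0 t) (e_le t t_ge0)) _.
  have {}h3 := h3 ltac:(by rewrite /T; lra).
  set a1 := dotv (xt t) (dx t); set a2 := dotv (p t) (dy t).
  pose pert := alpha * dotv (xt t) (bL *m (diagc (e t) *m x t))
    + alpha * dotv (p t) (bA *m bL *m (diagc (e t) *m x t))
    + gamma * dotv (p t) (bL *m (diagc (e t) *m y t)).
  (* Half of the derivative of [W]. *)
  have {}balance : a1 + a2 = - F - pert by exact: balance.
  have pert_le : - pert <= H * eps t * T.
    move/(ler_wpM2l (ltW alpha_gt0)): h1; move/(ler_wpM2l (ltW alpha_gt0)): h2.
    move/(ler_wpM2l (ltW gamma_gt0)): h3; rewrite /H /pert; lra.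
  have HT : H * eps t * T <= H * eps t * ((3 + 2 * D + 2 * dotv X X) * (W t + 1)).
    by apply: ler_wpM2l => //; rewrite mulr_ge0 // ltW.
  have kE : k * expR (- (rho / 2) * t) * (W t + 1) =
      2 * (H * eps t * ((3 + 2 * D + 2 * dotv X X) * (W t + 1))).
    by rewrite /k /eps; ring.
  rewrite kE; clearbody F pert; move: balance W_le pert_le HT; lra.
pose nu := Num.min mu rho; pose E := 1 + 2 * (1 + D).
have nu_gt0 : 0 < nu by rewrite lt_min mu_gt0.
have E_ge0 : 0 <= E by rewrite /E; lra.
apply: (@converges_exponentially_dotv _ _ _ _ (E * C + Cv) nu) => //.
  by rewrite addr_ge0 // mulr_ge0.
move=> t t_ge0; rewrite !opp_col_mx !add_col_mx !dotv_col_mx subr0 -/(xt t) -/(e t).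
have exp_le a : nu <= a -> expR (- a * t) <= expR (- nu * t).
  by move=> na; rewrite ler_expR !mulNr lerN2 ler_wpM2r.
have v_le_nu : dotv (e t) (e t) <= Cv * expR (- nu * t).
  apply: le_trans (v_le t t_ge0) _; apply: ler_wpM2l => //.
  by apply: exp_le; rewrite ge_min lexx orbT.
have W_le_nu : W t <= C * expR (- nu * t).
  apply: le_trans (W_le t t_ge0) _; apply: ler_wpM2l => //.
  by apply: exp_le; rewrite ge_min lexx.
have := y_le t t_ge0; have := ler_wpM2l E_ge0 W_le_nu; rewrite /E /W.
have xx := dotvv_ge0 (xt t); have pp := dotvv_ge0 (p t).
have := mulr_ge0 D_ge0 pp; have := mulr_ge0 D_ge0 xx; lra.
Qed.

End Trajectory.

Theorem theoremV1 (R : realType) (n m : nat) (n_ge2 : (2 <= n)%N)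
    (G : wdigraph R n) (Gsc : strongly_connected G)
    (A : 'I_n -> 'M[R]_m) (b : 'I_n -> 'cV[R]_m)
    (solvable : exists x : 'cV[R]_m, (\sum_(i < n) A i) *m x = \sum_(i < n) b i)
    (nullA : forall i : 'I_n, null (\sum_(j < n) A j) `<=` null (A i))
    (vbar : 'cV[R]_n)
    (vbar_ker : laplacian G *m vbar = 0)
    (vbar_gt0 : forall i : 'I_n, 0 < vbar i 0)
    (vbar_sum : \sum_(i < n) vbar i 0 = 1)
    (alpha beta : R) (alpha_gt0 : 0 < alpha) (beta_gt0 : 0 < beta)
    (gamma : R) (gamma_gt : gamma_bar (laplacian G) A vbar alpha beta < gamma)
    (x y v : R -> 'cV[R]_(n * m)) :
  let bL := laplacian G *t 1%:M : 'M[R]_(n * m) in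
  let bA := blkdiag A in
  let V t := diagc (v t) in
  has_deriv_nonneg x (fun t =>
    - (alpha *: (bL *m V t *m x t)) - (n%:R * beta) *: (bA^T *m y t)) ->
  has_deriv_nonneg y (fun t =>
    - (alpha *: (bA *m bL *m V t *m x t))
    - (n%:R * beta) *: (bA *m bA^T *m y t)
    - gamma *: (bL *m V t *m y t)) ->
  has_deriv_nonneg v (fun t => - (bL *m v t)) ->
  Umx^T *m y 0 = Umx^T *m (bA *m x 0 - stack b) ->
  v 0 = n%:R^-1 *: ones ->
  exists xstar : 'cV[R]_m,
    (\sum_(i < n) A i) *m xstar = \sum_(i < n) b i /\
    converges_exponentially
      (fun t => col_mx (x t) (col_mx (y t) (v t)))
      (col_mx (tensc ones xstar) (col_mx 0 (tensc vbar ones))).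
Proof.
move=> bL bA V xP yP vP y0P v0P.
have [m0|m_gt0] := posnP m.
  (* The state space is trivial, and [Q11] has no eigenvalue. *)
  have [xstar Axstar] := solvable; exists xstar; split=> //.
  apply: (@converges_exponentially_dotv _ _ _ _ 0 1) => // t _.
  rewrite mul0r /dotv big1 // => q _.
  exfalso; move: (ltn_ord q); move: (nat_of_ord q) => k.
  by rewrite m0 !muln0.
apply: (trajectory_converges n_ge2 Gsc vbar_ker vbar_gt0 vbar_sum nullA solvable
  alpha_gt0 beta_gt0 gamma_gt _ _ _ y0P v0P m_gt0); exact: has_deriv_nonneg_vec.
Qed.
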